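(* Let $(A,\mathfrak m)$ be a Noetherian local ring, $\mathfrak q\subset A$ an ideal, $M$ a finitely generated $A$-module. Let $\underline a=a_1,\ldots,a_d$ and $\underline b=b_1,\ldots,b_t$ be two systems of elements of $A$, with $a_i\in\mathfrak q^{c_i}\setminus\mathfrak q^{c_i+1}$, $c_i>0$, and with initial forms $b_j^\star$ of degree $\beta_j$. Let $L_i(\underline a,\mathfrak q,M;n)$ be the $i$-th homology of the complex $\mathcal L_\bullet(\underline a,\mathfrak q,M;n)$ defined in the context. (1) The following are equivalent: (a) $\underline a^\star=a_1^\star,\ldots,a_d^\star$ is a $G_M(\mathfrak q)$-regular sequence. (b) $L_1(\underline a,\mathfrak q,M;n)=0$ for all $n$. (c) $L_i(\underline a,\mathfrak q,M;n)=0$ for all $i>0$ and for all $n$. (2) If $\underline a^\star G_A(\mathfrak q)$ contains a $G_M(\mathfrak q)$-regular sequence $\underline b^\star=b_1^\star,\ldots,b_t^\star$, then $$L_i(\underline a,\mathfrak q,M;n)=0\quad\text{for all } i>d-t\text{ and for all }n.$$ The converse is also true: if $L_i(\underline a,\mathfrak q,M;n)=0$ for all $i>d-t$ and for all $n$, then $\underline a^\star G_A(\mathfrak q)$ contains a $G_M(\mathfrak q)$-regular sequence $b_1^\star,\ldots,b_t^\star$. Moreover, given such a $G_M(\mathfrak q)$-regular sequence $\underline b^\star=b_1^\star,\ldots,b_t^\star$ in $\underline a^\star G_A(\mathfrak q)$, choose the elements $b_1,\ldots,b_t\in A$ so that their initial forms are the given $b_1^\star,\ldots,b_t^\star$ and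 $(b_1,\ldots,b_t)A\subseteq(a_1,\ldots,a_d)A$. Then there is an isomorphism $$L_{d-t}(\underline a,\mathfrak q,M;n)\ \cong\ \Big(\bigcap_{i=1}^d\big((\underline b,\mathfrak q^{\,n+\beta-\overline{c_i}})M:_Ma_i\big)\Big)\Big/(\underline b,\mathfrak q^{\,n+\beta-\overline c})M,$$ where $\overline c=\sum_{i=1}^dc_i$, $\overline{c_i}=c_1+\ldots+c_{i-1}+c_{i+1}+\ldots+c_d$ and $\beta=\sum_{j=1}^t\beta_j$.
   Context: $G_A(\mathfrak q)=\bigoplus_{n\ge0}\mathfrak q^n/\mathfrak q^{n+1}$ and $G_M(\mathfrak q)=\bigoplus_{n\ge0}\mathfrak q^nM/\mathfrak q^{n+1}M$. For $a\in\mathfrak q^{c}\setminus\mathfrak q^{c+1}$ the initial form is $a^\star:=a+\mathfrak q^{c+1}\in[G_A(\mathfrak q)]_c$, of degree $c$; $\underline a^\star G_A(\mathfrak q)$ is the ideal generated by $a_1^\star,\ldots,a_d^\star$. A sequence is regular on a module if each element is a nonzerodivisor on the quotient of the module by the preceding ones. For a submodule $N\subseteq M$, $N:_Ma=\{m\in M: am\in N\}$; $(\underline b,\mathfrak q^m)M=(b_1,\ldots,b_t)M+\mathfrak q^mM$. Convention: $\mathfrak q^nM=0$ for $n<0$. The complex $\mathcal L_\bullet(\underline a,\mathfrak q,M;n)$, for a non-negative integer $n$: let $K_\bullet(\underline a;M)$ be the Koszul complex, with $K_i(\underline a;M)=\bigoplus_{1\le j_1<\cdots<j_i\le d}M\,e_{j_1}\wedge\cdots\wedge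 e_{j_i}$ and differential $e_{j_1}\wedge\cdots\wedge e_{j_i}\mapsto\sum_{k=1}^i(-1)^{k+1}a_{j_k}e_{j_1}\wedge\cdots\wedge\widehat{e_{j_k}}\wedge\cdots\wedge e_{j_i}$. Let $K_\bullet(\underline a,\mathfrak q,M;n)$ be the subcomplex with $K_i(\underline a,\mathfrak q,M;n)=\bigoplus_{1\le j_1<\cdots<j_i\le d}\mathfrak q^{n-c_{j_1}-\cdots-c_{j_i}}M$ for $0\le i\le d$ and zero otherwise, with restricted differentials. Then $\mathcal L_\bullet(\underline a,\mathfrak q,M;n)=K_\bullet(\underline a;M)/K_\bullet(\underline a,\mathfrak q,M;n)$, so $\mathcal L_i(\underline a,\mathfrak q,M;n)\cong\bigoplus_{j_1<\cdots<j_i}M/\mathfrak q^{n-c_{j_1}-\cdots-c_{j_i}}M$, with differentials induced by the Koszul complex, and $L_i(\underline a,\mathfrak q,M;n)=H_i(\mathcal L_\bullet(\underline a,\mathfrak q,M;n))$.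
   Formalization: The convention is q^nM = M for n<0 (with q^nM = 0, (1) fails for d=1, n=0); in the ''moreover'' the chosen b_j must be sums of r_i a_i with r_i in q^(β_j−c_i), since other choices can fail, and such b_j are shown to exist; the converse in (2) excludes d=0<t, where it is false. *)

(* Defs.v *)
From HB Require Import structures.
From mathcomp Require Import all_boot all_algebra.
From mathcomp Require Import boolp functions.

Set Implicit Arguments.
Unset Strict Implicit.
Unset Printing Implicit Defensive.

Import GRing.Theory.
Local Open Scope ring_scope.
Local Open Scope quotient_scope.

Record submodule (R : pzRingType) (V : lmodType R) := Submodule {
  smem :> V -> Prop;
  smem0 : smem 0;
  smem_lin : forall (a : R) (x y : V), smem x -> smem y -> smem (a *: x + y)
}.

Section SubmoduleTypes.
Variables (R : pzRingType) (V : lmodType R).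
Implicit Types (N : submodule V) (S : V -> Prop).

Lemma smemD N x y : N x -> N y -> N (x + y).
Proof. by move=> Nx Ny; rewrite -[x]scale1r; apply: smem_lin. Qed.

Lemma smemZ N a x : N x -> N (a *: x).
Proof. by move=> Nx; rewrite -[_ *: _]addr0; apply: smem_lin (smem0 N). Qed.

Lemma smemN N x : N x -> N (- x).
Proof. by rewrite -scaleN1r; apply: smemZ. Qed.

Lemma smemB N x y : N x -> N y -> N (x - y).
Proof. by move=> Nx /smemN; apply: smemD. Qed.

Lemma smem_sum N (I : Type) (r : seq I) (P : pred I) (F : I -> V) :
  (forall i, P i -> N (F i)) -> N (\sum_(i <- r | P i) F i).
Proof.
by move=> h; elim/big_ind: _ => //; [apply: smem0 | move=> x y; apply: smemD].
Qed.

Definition smemb N : {pred V} := fun x => `[< N x >].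

Lemma smemb_closed N : submod_closed (smemb N).
Proof.
split=> [|a x y /asboolP Nx /asboolP Ny]; apply/asboolP; first exact: smem0.
exact: smem_lin.
Qed.

HB.instance Definition _ N :=
  GRing.isSubmodClosed.Build R V (smemb N) (smemb_closed N).

Record sub_lmod N := SubLmod { sval_lmod : V; svalP : sval_lmod \in smemb N }.
HB.instance Definition _ N := [isSub for @sval_lmod N].
HB.instance Definition _ N := [Choice of sub_lmod N by <:].
HB.instance Definition _ N := [SubChoice_isSubLmodule of sub_lmod N by <:].

Definition quot_lmod N := Quotient.quot (smemb N).
HB.instance Definition _ N := GRing.Zmodule.on (quot_lmod N).

Definition qpi N (x : V) : quot_lmod N := \pi_(Quotient.quot (smemb N)) x.
Definition qrepr N (y : quot_lmod N) : V :=
  repr (y : Quotient.quot (smemb N)).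

Lemma qreprK N : cancel (@qrepr N) (@qpi N).
Proof. exact: reprK. Qed.

Lemma qpiP N x y : qpi N x = qpi N y <-> N (x - y).
Proof.
split=> [/eqP|h]; first by rewrite /qpi -Quotient.idealrBE => /asboolP.
by apply/eqP; rewrite /qpi -Quotient.idealrBE; apply/asboolP.
Qed.

Lemma qpiD N : {morph @qpi N : x y / x + y}.
Proof. by move=> x y; rewrite /qpi raddfD. Qed.

Definition qscale N (a : R) (y : quot_lmod N) := qpi N (a *: qrepr y).

Lemma qscale_pi N a x : qscale a (qpi N x) = qpi N (a *: x).
Proof.
apply/qpiP; rewrite -scalerBr; apply: smemZ.
by apply/qpiP; rewrite qreprK.
Qed.

Fact qscaleA N a b (y : quot_lmod N) : qscale a (qscale b y) = qscale (a * b) y.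
Proof. by rewrite -(qreprK y) !qscale_pi scalerA. Qed.

Fact qscale1 N : left_id 1 (@qscale N).
Proof. by move=> y; rewrite -(qreprK y) qscale_pi scale1r. Qed.

Fact qscaleDr N : right_distributive (@qscale N) +%R.
Proof.
move=> a y z; rewrite -(qreprK y) -(qreprK z) -qpiD !qscale_pi -qpiD.
by rewrite scalerDr.
Qed.

Fact qscaleDl N (y : quot_lmod N) : {morph (@qscale N)^~ y : a b / a + b}.
Proof. by move=> a b /=; rewrite -(qreprK y) !qscale_pi -qpiD scalerDl. Qed.

HB.instance Definition _ N := GRing.Zmodule_isLmodule.Build R (quot_lmod N)
  (@qscaleA N) (@qscale1 N) (@qscaleDr N) (@qscaleDl N).

Fact qpi_linear N : linear (@qpi N).
Proof. by move=> a x y; rewrite qpiD -qscale_pi. Qed.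

HB.instance Definition _ N :=
  GRing.isLinear.Build R V (quot_lmod N) _ (@qpi N) (@qpi_linear N).

End SubmoduleTypes.

Local Obligation Tactic := idtac.

Section SubmoduleOps.
Variables (R : pzRingType).
Implicit Types (U V : lmodType R).

Definition full_sub V : submodule V :=
  @Submodule R V (fun=> True) I (fun _ _ _ _ _ => I).

Program Definition submod_span V (S : V -> Prop) : submodule V :=
  @Submodule R V (fun x => forall N : submodule V, (forall y, S y -> N y) -> N x)
    _ _.
Next Obligation. by move=> V S N _; exact: smem0. Qed.
Next Obligation.
by move=> V S a x y hx hy N hN; apply: smem_lin; [apply: hx | apply: hy].
Qed.

Program Definition submod_comap U V (f : {linear U -> V}) (N : submodule V) :
  submodule U := @Submodule R U (fun x => N (f x)) _ _.
Next Obligation. by move=> U V f N /=; rewrite linear0; exact: smem0. Qed.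
Next Obligation. by move=> U V f N a x y hx hy /=; rewrite linearP; apply: smem_lin. Qed.

Program Definition submod_ker U V (f : {linear U -> V}) : submodule U :=
  @Submodule R U (fun x => f x = 0) _ _.
Next Obligation. by move=> U V f /=; rewrite linear0. Qed.
Next Obligation. by move=> U V f a x y hx hy /=; rewrite linearP hx hy scaler0 addr0. Qed.

Program Definition submod_im U V (f : {linear U -> V}) : submodule V :=
  @Submodule R V (fun y => exists x, y = f x) _ _.
Next Obligation. by move=> U V f /=; exists 0; rewrite linear0. Qed.
Next Obligation.
by move=> U V f a _ _ [x ->] [y ->] /=; exists (a *: x + y); rewrite linearP.
Qed.

Program Definition submod_bigcap V (I : Type) (N : I -> submodule V) :
  submodule V := @Submodule R V (fun x => forall i, N i x) _ _.
Next Obligation. by move=> V I N i; apply: smem0. Qed.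
Next Obligation. by move=> V I N a x y hx hy i; apply: smem_lin. Qed.

Program Definition submod_add V (N P : submodule V) : submodule V :=
  @Submodule R V (fun z => exists x y, [/\ N x, P y & z = x + y]) _ _.
Next Obligation. by move=> V N P; exists 0, 0; split; rewrite ?addr0 //; apply: smem0. Qed.
Next Obligation.
move=> V N P a _ _ [x [y [Nx Py ->]]] [x' [y' [Nx' Py' ->]]].
exists (a *: x + x'), (a *: y + y'); split; try exact: smem_lin.
by rewrite scalerDr addrACA.
Qed.

(* Z / B; when B is not contained in Z this reads Z / (Z `&` B). *)
Definition subquotient V (Z B : submodule V) : lmodType R :=
  quot_lmod (submod_comap (\val : {linear sub_lmod Z -> V}) B).

Definition lmod_iso U V : Prop := exists f : {linear U -> V}, bijective f.

Definition lmod_trivial V : Prop := forall x : V, x = 0.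

Definition finitely_generated V (N : submodule V) : Prop :=
  exists s : seq V, forall x, N x <-> submod_span (fun y => y \in s) x.

End SubmoduleOps.

Definition ideal (A : pzRingType) := submodule A^o.

Section Ideals.
Variable A : comPzRingType.
Implicit Types (I J m : ideal A) (M : lmodType A).

Definition noetherian : Prop := forall I, finitely_generated I.

Definition maximal_ideal m : Prop :=
  ~ m 1 /\ forall I, (forall x, m x -> I x) -> ~ I 1 -> forall x, I x -> m x.

Definition local_ring m : Prop :=
  maximal_ideal m /\
  forall m', maximal_ideal m' -> forall x, m' x <-> m x.

Definition ideal_mul M I (N : submodule M) : submodule M :=
  submod_span (fun z => exists a x, [/\ I a, N x & z = a *: x]).

Fixpoint idpow I (n : nat) : ideal A :=
  if n is n'.+1 then @ideal_mul A^o I (idpow I n') else full_sub A^o.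

(* (q ^ k) M = M for k < 0. Taking it to be 0 instead would make H_1 of the   *)
(* quotient complex below nonzero for d = 1, n = 0 and any nonzero M, even if *)
(* a^* is regular: its differential in degree 1 would be M -> M / M.          *)
Definition idpowz I (k : int) : ideal A :=
  match k with Posz n => idpow I n | Negz _ => full_sub A^o end.

Definition filt I M (k : int) : submodule M :=
  ideal_mul (idpowz I k) (full_sub M).

(* The ideal (x_1, ..., x_n) A. *)
Definition ideal_gen n (x : 'I_n -> A) : ideal A :=
  @submod_span A A^o (fun y => exists i, y = x i).

Program Definition colon M (N : submodule M) (a : A) : submodule M :=
  @Submodule A M (fun x => N (a *: x)) _ _.
Next Obligation. by move=> M N a /=; rewrite scaler0; apply: smem0. Qed.
Next Obligation.
move=> M N a b x y hx hy /=.
by rewrite scalerDr scalerA mulrC -scalerA; apply: smem_lin.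
Qed.

Definition regular_seq M n (x : 'I_n -> A) : Prop :=
  forall k : 'I_n,
    let Q := quot_lmod (ideal_mul
      (@submod_span A A^o (fun y => exists2 j : 'I_n, (j < k)%N & y = x j))
      (full_sub M)) in
    forall y : Q, x k *: y = 0 -> y = 0.

Lemma spanS (V : lmodType A) (S : V -> Prop) y : S y -> submod_span S y.
Proof. by move=> Sy N; apply. Qed.

Lemma ideal_mulE M I (N : submodule M) a x :
  I a -> N x -> ideal_mul I N (a *: x).
Proof. by move=> Ia Nx; apply: spanS; exists a, x. Qed.

Lemma idpow_mul I i j a b :
  idpow I i a -> idpow I j b -> idpow I (i + j) (a * b).
Proof.
elim: i a b => [|i IH] a b; first by move=> _ jb; apply: (@smemZ _ A^o).
move=> ia jb; rewrite mulrC.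
apply: (ia (colon (idpow I (i.+1 + j)) b)) => _ [c [x [Ic ix ->]]] /=.
rewrite /GRing.scale /= mulrCA [b * x]mulrC.
by apply: (@ideal_mulE A^o I _ c (x * b)) => //; apply: IH.
Qed.

Lemma idpowS I n a : idpow I n.+1 a -> idpow I n a.
Proof.
move=> h; apply: (h (idpow I n)) => _ [c [x [_ nx ->]]].
exact: smemZ.
Qed.

Lemma idpow_anti I i j a : (j <= i)%N -> idpow I i a -> idpow I j a.
Proof.
move=> /subnK <-; elim: (i - j)%N => // k IH /idpowS; exact: IH.
Qed.

Lemma filt_scale I M (c : nat) (k : int) a (x : M) :
  idpow I c a -> filt I M k x -> filt I M (k + c%:Z) (a *: x).
Proof.
move=> ca kx; apply: (kx (colon (filt I M (k + c%:Z)) a)).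
move=> _ [b [y [kb _ ->]]] /=; rewrite scalerA.
suff h : idpowz I (k + c%:Z) (a * b) by apply: (ideal_mulE (N := full_sub M) h).
case: k {kx} kb => [k|k] kb.
  by rewrite -PoszD mulrC; apply: idpow_mul.
case E: (_ + _)%R => [e|//] /=; rewrite mulrC; apply: (@smemZ _ A^o).
apply: idpow_anti ca.
by rewrite -(lez_nat) -E NegzE Num.Theory.gerDr Num.Theory.oppr_le0.
Qed.

End Ideals.

(* The direct sum of the q^n / q^(n+1) is realised as the quotient of the     *)
(* direct sum of the q^n (the Rees algebra, inside {poly A}) by the direct    *)
(* sum of the q^(n+1); likewise for M, with finitely supported sequences.     *)
Section GradedRing.
Variables (A : comNzRingType) (q : ideal A).

Definition reesb : {pred {poly A}} :=
  fun p => `[< forall n, idpow q n p`_n >].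

Fact reesb_closed : subring_closed reesb.
Proof.
split=> [|p r /asboolP hp /asboolP hr|p r /asboolP hp /asboolP hr];
  apply/asboolP => n.
- rewrite coef1; case: n => [|n]; first exact: I.
  exact: (@smem0 _ A^o).
- by rewrite coefB; apply: (@smemB _ A^o).
- rewrite coefM; apply: (@smem_sum _ A^o) => j _.
  have jn : (j <= n)%N by rewrite -ltnS.
  by rewrite -[X in idpow q X](subnKC jn); apply: idpow_mul.
Qed.

HB.instance Definition _ :=
  GRing.isSubringClosed.Build {poly A} reesb reesb_closed.

Record rees := Rees { rees_val : {poly A}; reesP : rees_val \in reesb }.
HB.instance Definition _ := [isSub for rees_val].
HB.instance Definition _ := [Choice of rees by <:].
HB.instance Definition _ := [SubChoice_isSubComNzRing of rees by <:].

Definition rees_nullb : {pred rees} :=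
  fun p => `[< forall n, idpow q n.+1 (val p)`_n >].

Fact rees_nullb_closed : zmod_closed rees_nullb.
Proof.
split=> [|p r /asboolP hp /asboolP hr]; apply/asboolP => n.
  by rewrite coef0; exact: (@smem0 _ A^o).
by rewrite coefB; apply: (@smemB _ A^o).
Qed.

HB.instance Definition _ :=
  GRing.isZmodClosed.Build rees rees_nullb rees_nullb_closed.

Definition gr_ring := Quotient.quot rees_nullb.
HB.instance Definition _ := GRing.Zmodule.on gr_ring.

Definition gr_pi (p : rees) : gr_ring := \pi_(Quotient.quot rees_nullb) p.
Definition gr_repr (g : gr_ring) : rees := repr (g : Quotient.quot rees_nullb).

Lemma gr_reprK : cancel gr_repr gr_pi.
Proof. exact: reprK. Qed.

Lemma gr_piP p r : gr_pi p = gr_pi r <-> p - r \in rees_nullb.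
Proof.
by split=> [/eqP|h]; [|apply/eqP]; rewrite /gr_pi -Quotient.idealrBE.
Qed.

Lemma gr_piD : {morph gr_pi : p r / p + r}.
Proof. by move=> p r; rewrite /gr_pi raddfD. Qed.

Lemma rees_null_mul p r : r \in rees_nullb -> p * r \in rees_nullb.
Proof.
move=> /asboolP hr; apply/asboolP => n.
rewrite (_ : val (p * r) = val p * val r) // coefM.
apply: (@smem_sum _ A^o) => j _.
have jn : (j <= n)%N by rewrite -ltnS.
rewrite -[X in idpow q X.+1](subnKC jn) -addnS; apply: idpow_mul => //.
by have /asboolP h := valP p.
Qed.

Definition gr_one := gr_pi 1.
Definition gr_mul (g h : gr_ring) := gr_pi (gr_repr g * gr_repr h).

Lemma gr_mul_pi p r : gr_mul (gr_pi p) (gr_pi r) = gr_pi (p * r).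
Proof.
apply/gr_piP; set p' := gr_repr _; set r' := gr_repr _.
have hp : p' - p \in rees_nullb by apply/gr_piP; rewrite gr_reprK.
have hr : r' - r \in rees_nullb by apply/gr_piP; rewrite gr_reprK.
have -> : p' * r' - p * r = p' * (r' - r) + r * (p' - p).
  by rewrite !mulrBr addrA [r * p']mulrC [r * p]mulrC subrK.
by apply: rpredD; apply: rees_null_mul.
Qed.

Fact gr_mulA : associative gr_mul.
Proof.
move=> g h k; rewrite -(gr_reprK g) -(gr_reprK h) -(gr_reprK k).
by rewrite !gr_mul_pi mulrA.
Qed.

Fact gr_mulC : commutative gr_mul.
Proof. by move=> g h; rewrite /gr_mul mulrC. Qed.

Fact gr_mul1 : left_id gr_one gr_mul.
Proof. by move=> g; rewrite -(gr_reprK g) gr_mul_pi mul1r. Qed.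

Fact gr_mulDl : left_distributive gr_mul +%R.
Proof.
move=> g h k; rewrite -(gr_reprK g) -(gr_reprK h) -(gr_reprK k).
by rewrite -gr_piD !gr_mul_pi -gr_piD mulrDl.
Qed.

(* Only a pzRing: G_A(q) is the zero ring when q = A. *)
HB.instance Definition _ := GRing.Zmodule_isComPzRing.Build gr_ring
  gr_mulA gr_mulC gr_mul1 gr_mulDl.

Definition has_order (a : A) (c : nat) : Prop :=
  idpow q c a /\ ~ idpow q c.+1 a.

Fact rees_monomial a c : idpow q c a -> a *: 'X^c \in reesb.
Proof.
move=> ha; apply/asboolP => n; rewrite coefZ coefXn.
by case: eqP => [->|_]; rewrite ?mulr1 ?mulr0 //; exact: (@smem0 _ A^o).
Qed.

(* The class of a in degree c. *)
Definition init_form a c (h : has_order a c) : gr_ring :=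
  gr_pi (Rees (rees_monomial h.1)).

End GradedRing.

Section GradedModule.
Variables (A : comNzRingType) (q : ideal A) (M : lmodType A).

Definition reesm_pred (x : nat -> M) : Prop :=
  (forall n : nat, filt q M n (x n)) /\
  exists N : nat, forall n : nat, (N <= n)%N -> x n = 0.

Definition reesmb : {pred nat -> M} := fun x => `[< reesm_pred x >].

Fact reesmb_closed : zmod_closed reesmb.
Proof.
split=> [|x y /asboolP[hx [N hN]] /asboolP[hy [P hP]]]; apply/asboolP; split.
- by move=> n; exact: smem0.
- by exists 0%N.
- by move=> n; exact: smemB.
exists (maxn N P) => n; rewrite geq_max => /andP[/hN xn /hP yn].
by rewrite (_ : (x - y) n = x n - y n) // xn yn subr0.
Qed.

HB.instance Definition _ :=
  GRing.isZmodClosed.Build (nat -> M) reesmb reesmb_closed.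

Record reesm := Reesm { reesm_val : nat -> M; reesmP : reesm_val \in reesmb }.
HB.instance Definition _ := [isSub for reesm_val].
HB.instance Definition _ := [Choice of reesm by <:].
HB.instance Definition _ := [SubChoice_isSubZmodule of reesm by <:].

Definition reesm_nullb : {pred reesm} :=
  fun x => `[< forall n : nat, filt q M n.+1 (val x n) >].

Fact reesm_nullb_closed : zmod_closed reesm_nullb.
Proof.
split=> [|x y /asboolP hx /asboolP hy]; apply/asboolP => n.
  exact: smem0.
exact: smemB.
Qed.

HB.instance Definition _ :=
  GRing.isZmodClosed.Build reesm reesm_nullb reesm_nullb_closed.

Definition gr_mod := Quotient.quot reesm_nullb.
HB.instance Definition _ := GRing.Zmodule.on gr_mod.

Definition grm_pi (x : reesm) : gr_mod := \pi_(Quotient.quot reesm_nullb) x.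
Definition grm_repr (g : gr_mod) : reesm := repr (g : Quotient.quot reesm_nullb).

Lemma grm_reprK : cancel grm_repr grm_pi.
Proof. exact: reprK. Qed.

Lemma grm_piP x y : grm_pi x = grm_pi y <-> x - y \in reesm_nullb.
Proof.
by split=> [/eqP|h]; [|apply/eqP]; rewrite /grm_pi -Quotient.idealrBE.
Qed.

Lemma grm_piD : {morph grm_pi : x y / x + y}.
Proof. by move=> x y; rewrite /grm_pi raddfD. Qed.

Definition conv (p : {poly A}) (x : nat -> M) : nat -> M :=
  fun n => \sum_(j < n.+1) p`_j *: x (n - j)%N.

Fact conv_closed (p : rees q) (x : reesm) : conv (val p) (val x) \in reesmb.
Proof.
case: p x => p /asboolP hp [x /asboolP[hx [N hN]]] /=; apply/asboolP; split.
  move=> n; apply: smem_sum => j _; have jn : (j <= n)%N by rewrite -ltnS.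
  by rewrite -[X in filt q M (Posz X)](subnK jn) PoszD; apply: filt_scale.
exists (size p + N)%N => n hn; apply: big1 => j _.
have [jp|pj] := ltnP j (size p); last by rewrite nth_default ?scale0r.
rewrite hN ?scaler0 // leq_subRL; last by rewrite -ltnS.
by apply: leq_trans hn; rewrite leq_add2r ltnW.
Qed.

Definition rees_act (p : rees q) (x : reesm) : reesm := Reesm (conv_closed p x).

Fact convA (p r : {poly A}) x : conv p (conv r x) = conv (p * r) x.
Proof.
apply: funext => n; rewrite /conv.
pose F (j k : 'I_n.+1) : M :=
  if (j <= k)%N then (p`_j * r`_(k - j)) *: x (n - k)%N else 0.
transitivity (\sum_j \sum_k F j k); last rewrite exchange_big.
  apply: eq_bigr => j _; rewrite scaler_sumr /F -big_mkcond /=.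
  have jn : (j <= n)%N by rewrite -ltnS.
  rewrite -(big_mkord xpredT (fun i => p`_j *: (r`_i *: x (n - j - i)%N))).
  rewrite -(big_mkord (fun k => j <= k)%N
    (fun k => (p`_j * r`_(k - j)) *: x (n - k)%N)).
  rewrite [RHS](@big_cat_nat _ _ _ j) /= ?leqW //.
  rewrite [X in _ = X + _]big_nat_cond [X in _ = X + _]big1 ?add0r.
    rewrite [RHS](_ : _ = \sum_(0 + j <= k < n.+1 | (j <= k)%N)
      (p`_j * r`_(k - j)) *: x (n - k)%N) // big_addn.
    rewrite subSn // big_nat_cond [RHS]big_nat_cond.
    apply: eq_big => i; first by rewrite leq_addl andbT.
    by move=> _; rewrite addnK scalerA addnC subnDA.
  by move=> i /andP[/andP[_ ij]]; rewrite leqNgt ij.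
apply: eq_bigr => k _; rewrite coefM scaler_suml /F -big_mkcond /=.
have kn : (k.+1 <= n.+1)%N by [].
rewrite (big_ord_widen n.+1 (fun i => (p`_i * r`_(k - i)) *: x (n - k)%N) kn).
by apply: eq_bigl => i; rewrite ltnS.
Qed.

Fact rees_actA p r x : rees_act p (rees_act r x) = rees_act (p * r) x.
Proof. by apply: val_inj; rewrite /= convA. Qed.

Fact rees_act1 x : rees_act 1 x = x.
Proof.
apply: val_inj; apply: funext => n /=; rewrite /conv big_ord_recl /= subn0.
rewrite big1 ?addr0 ?coef1 ?scale1r // => j _.
by rewrite coef1 scale0r.
Qed.

Fact rees_actDr p : {morph rees_act p : x y / x + y}.
Proof.
move=> x y; apply: val_inj; apply: funext => n.
rewrite [RHS](_ : _ = conv (val p) (val x) n + conv (val p) (val y) n) //.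
rewrite [LHS](_ : _ = conv (val p) (val x + val y) n) // /conv -big_split /=; apply: eq_bigr => j _; exact: scalerDr.
Qed.

Fact rees_actDl x : {morph rees_act^~ x : p r / p + r}.
Proof.
move=> p r; apply: val_inj; apply: funext => n.
rewrite [RHS](_ : _ = conv (val p) (val x) n + conv (val r) (val x) n) //.
rewrite [LHS](_ : _ = conv (val p + val r) (val x) n) // /conv -big_split /=; apply: eq_bigr => j _.
by rewrite coefD scalerDl.
Qed.

Fact rees_act_nullr p x : x \in reesm_nullb -> rees_act p x \in reesm_nullb.
Proof.
case: p => p pP /asboolP hx; apply/asboolP => n; apply: smem_sum => j _.
have jn : (j <= n)%N by rewrite -ltnS.
rewrite -[X in filt q M (Posz X.+1)](subnK jn) -addSn PoszD.
by apply: filt_scale (hx _); have /asboolP h := pP.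
Qed.

Fact rees_act_nulll p x :
  p \in @rees_nullb A q -> rees_act p x \in reesm_nullb.
Proof.
case: x => x xP /asboolP hp; have /asboolP[hx _] := xP; apply/asboolP => n.
apply: smem_sum => j _; have jn : (j <= n)%N by rewrite -ltnS.
rewrite -[X in filt q M (Posz X.+1)](subnK jn) -addnS PoszD.
exact: filt_scale.
Qed.

Definition gr_scale (g : gr_ring q) (y : gr_mod) : gr_mod :=
  grm_pi (rees_act (gr_repr g) (grm_repr y)).

Lemma gr_scale_pi p x : gr_scale (gr_pi p) (grm_pi x) = grm_pi (rees_act p x).
Proof.
apply/grm_piP; set p' := gr_repr _; set x' := grm_repr _.
have hp : p' - p \in @rees_nullb A q by apply/gr_piP; rewrite gr_reprK.
have hx : x' - x \in reesm_nullb by apply/grm_piP; rewrite grm_reprK.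
have -> : rees_act p' x' = rees_act (p' - p) x' +
    (rees_act p (x' - x) + rees_act p x).
  by rewrite -rees_actDr subrK -rees_actDl subrK.
rewrite addrA addrK; apply: rpredD; first exact: rees_act_nulll.
exact: rees_act_nullr.
Qed.

Fact gr_scaleA g h y : gr_scale g (gr_scale h y) = gr_scale (g * h) y.
Proof.
rewrite -(gr_reprK g) -(gr_reprK h) -(grm_reprK y).
rewrite [_ * _](gr_mul_pi (gr_repr g) (gr_repr h)) !gr_scale_pi.
by rewrite rees_actA.
Qed.

Fact gr_scale1 : left_id 1 gr_scale.
Proof. by move=> y; rewrite -(grm_reprK y) gr_scale_pi rees_act1. Qed.

Fact gr_scaleDr : right_distributive gr_scale +%R.
Proof.
move=> g y z; rewrite -(gr_reprK g) -(grm_reprK y) -(grm_reprK z) -grm_piD.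
by rewrite !gr_scale_pi -grm_piD rees_actDr.
Qed.

Fact gr_scaleDl y : {morph gr_scale^~ y : g h / g + h}.
Proof.
move=> g h /=; rewrite -(gr_reprK g) -(gr_reprK h) -(grm_reprK y) -gr_piD.
by rewrite !gr_scale_pi -grm_piD rees_actDl.
Qed.

HB.instance Definition _ := GRing.Zmodule_isLmodule.Build (gr_ring q) gr_mod
  gr_scaleA gr_scale1 gr_scaleDr gr_scaleDl.

End GradedModule.

Section QuotientMap.
Variables (R : pzRingType) (U V : lmodType R) (f : {linear U -> V}).
Variables (N : submodule U) (P : submodule V) (fNP : forall x, N x -> P (f x)).

Definition quot_map_of of (forall x, N x -> P (f x)) :=
  fun y : quot_lmod N => qpi P (f (qrepr y)).
Definition quot_map := quot_map_of fNP.

Lemma quot_map_pi x : quot_map (qpi N x) = qpi P (f x).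
Proof.
by apply/qpiP; rewrite -linearB; apply: fNP; apply/qpiP; rewrite qreprK.
Qed.

Fact quot_map_linear : linear quot_map.
Proof.
move=> a y z; rewrite -(qreprK y) -(qreprK z) -linearP !quot_map_pi.
by rewrite -linearP linearP.
Qed.

HB.instance Definition _ :=
  GRing.isLinear.Build R (quot_lmod N) (quot_lmod P) _ quot_map quot_map_linear.

End QuotientMap.

Record chain_complex (R : pzRingType) := ChainComplex {
  chain : nat -> lmodType R;
  diff : forall i, {linear chain i.+1 -> chain i};
  diffK : forall i x, diff i (diff i.+1 x) = 0
}.

Section Homology.
Variables (R : pzRingType) (C : chain_complex R).

Definition cycles i : submodule (chain C i) :=
  match i with
  | 0%N => full_sub (chain C 0)
  | i'.+1 => submod_ker (diff C i')
  end.

Definition boundaries i : submodule (chain C i) := submod_im (diff C i).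

Definition homology i : lmodType R := subquotient (cycles i) (boundaries i).

End Homology.

Section Koszul.
Variables (A : comNzRingType) (M : lmodType A) (d : nat) (a : 'I_d -> A).

Local Notation idx i := {J : {set 'I_d} | #|J| == i}.

(* An i-chain is the family of its coefficients on the e_J, #|J| = i.         *)
Definition kchain i : lmodType A := {ffun idx i -> M}.

Definition kcoef i (x : kchain i) (J : {set 'I_d}) : M :=
  if insub J is Some J' then x J' else 0.

(* The number of elements of J below j; for j the k-th element of j |: J     *)
(* (counted from 1) this is k - 1, so the Koszul sign (-1)^(k+1) is           *)
(* (-1)^(below J j).                                                         *)
Definition below (J : {set 'I_d}) (j : 'I_d) : nat :=
  #|[set l in J | (l < j)%N]|.

(* The coefficient of e_J in the image of x: e_J occurs in the image of e_J'  *)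
(* exactly when J' = j |: J with j \notin J.                                 *)
Definition kdiff i (x : kchain i.+1) : kchain i :=
  [ffun J : idx i => \sum_(j | j \notin val J)
     (-1) ^+ below (val J) j *: (a j *: kcoef x (j |: val J))].

Fact kcoef_linear i J : linear ((@kcoef i)^~ J).
Proof.
move=> b x y /=; rewrite /kcoef; case: insub => [J'|]; first by rewrite !ffunE.
by rewrite scaler0 addr0.
Qed.

Fact kdiff_linear i : linear (@kdiff i).
Proof.
move=> b x y; apply/ffunP => J; rewrite !ffunE scaler_sumr -big_split /=.
apply: eq_bigr => j _; rewrite (kcoef_linear (j |: val J) b x y).
by rewrite !scalerDr !scalerA; rewrite [_ * b]mulrC mulrA.
Qed.

HB.instance Definition _ i :=
  GRing.isLinear.Build A (kchain i.+1) (kchain i) _ (@kdiff i) (@kdiff_linear i).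

Lemma kcoef_kdiff i (x : kchain i.+1) (J : {set 'I_d}) : #|J| = i ->
  kcoef (kdiff x) J =
  \sum_(j | j \notin J) (-1) ^+ below J j *: (a j *: kcoef x (j |: J)).
Proof. by move/eqP=> cJ; rewrite {1}/kcoef insubT ffunE. Qed.

Lemma belowU (J : {set 'I_d}) j k : j \notin J ->
  below (j |: J) k = ((j < k) + below J k)%N.
Proof.
move=> jJ; rewrite /below; case: ltnP => jk /=.
  rewrite (_ : [set _ in _ | _] = j |: [set l in J | (l < k)%N]).
    by rewrite cardsU1 inE (negPf jJ).
  by apply/setP=> l; rewrite !inE; case: eqP => // ->.
rewrite add0n; congr #|pred_of_set _|.
by apply/setP=> l; rewrite !inE; case: eqP => //= ->; rewrite ltnNge jk andbF.
Qed.

Fact kdiffK i (x : kchain i.+2) : kdiff (kdiff x) = 0.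
Proof.
apply/ffunP => -[J /= cJ]; rewrite !ffunE /=; set P := fun j => j \notin J.
pose T (j k : 'I_d) : M :=
  if [&& P j, P k & j != k] then
    (-1) ^+ (below J j + below (j |: J) k) *: ((a j * a k) *: kcoef x (k |: (j |: J)))
  else 0.
have TN (j k : 'I_d) : (j < k)%N -> T j k = - T k j.
  move=> jk; have njk : j != k by rewrite -val_eqE ltn_eqF.
  rewrite /T [k == j]eq_sym njk !andbT [P k && P j]andbC.
  case: ifP => [/andP[Pj Pk]|_]; last by rewrite oppr0.
  rewrite !belowU // jk ltnNge (ltnW jk) /= add0n [a k * a j]mulrC setUCA.
  by rewrite add1n addnS exprS mulN1r scaleNr addnC.
transitivity (\sum_j \sum_k T j k).
  rewrite big_mkcond; apply: eq_bigr => j _.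
  case: ifPn => Pj; last by rewrite big1 // => k _; rewrite /T /P (negPf Pj).
  rewrite kcoef_kdiff; last by rewrite cardsU1 Pj (eqP cJ).
  rewrite !scaler_sumr big_mkcond; apply: eq_bigr => k _.
  rewrite /T /P Pj !inE negb_or eq_sym andbC /=; case: ifP => // _.
  by rewrite !scalerA exprD; congr (_ *: _); rewrite -!mulrA; congr (_ * _); rewrite mulrCA.
have Tjj j : T j j = 0 by rewrite /T eqxx !andbF.
have split2 (F : 'I_d -> 'I_d -> M) : (forall j, F j j = 0) ->
    \sum_j \sum_k F j k =
    \sum_(j : 'I_d) \sum_(k : 'I_d | (j < k)%N) F j k +
    \sum_(j : 'I_d) \sum_(k : 'I_d | (k < j)%N) F j k.
  move=> F0; rewrite -big_split; apply: eq_bigr => j _ /=.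
  rewrite (bigID (fun k : 'I_d => (j < k)%N)) /=; congr (_ + _).
  rewrite (bigD1 j) /= ?ltnn // F0 add0r; apply: eq_bigl => k.
  by rewrite -leqNgt ltn_neqAle andbC.
rewrite split2 // [X in _ + X](exchange_big_dep xpredT) //= -big_split.
apply: big1 => j _; rewrite -big_split; apply: big1 => k jk /=.
by rewrite TN // addNr.
Qed.

Definition koszul : chain_complex A := ChainComplex kdiffK.

End Koszul.

Section LComplex.
Variables (A : comNzRingType) (q : ideal A) (M : lmodType A).
Variables (d : nat) (a : 'I_d -> A) (c : 'I_d -> nat).
Hypothesis ha : forall j, has_order q (a j) (c j).
Variable n : nat.

Program Definition ksub (i : nat) : submodule (kchain M d i) :=
  @Submodule A _ (fun x => forall J : {J : {set 'I_d} | #|J| == i},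
    filt q M (n%:Z - (\sum_(j in val J) c j)%N%:Z) (x J)) _ _.
Next Obligation. by move=> i J; rewrite ffunE; apply: smem0. Qed.
Next Obligation.
by move=> i b x y hx hy J; rewrite !ffunE; apply: smem_lin.
Qed.

Fact ksub_kdiff i x : ksub i.+1 x -> ksub i (kdiff a x).
Proof.
move=> hx J; rewrite ffunE; apply: smem_sum => j jJ; apply: smemZ.
rewrite /kcoef; case: insubP => [J' _ eJ|_]; last first.
  by rewrite scaler0; apply: smem0.
have := filt_scale (ha j).1 (hx J'); rewrite eJ big_setU1 //=.
by rewrite PoszD opprD addrA addrAC addrNK.
Qed.

Definition Lchain i : lmodType A := quot_lmod (ksub i).

Definition Ldiff i : {linear Lchain i.+1 -> Lchain i} :=
  quot_map (@ksub_kdiff i).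

Fact LdiffK i x : Ldiff i (Ldiff i.+1 x) = 0.
Proof.
rewrite -(qreprK x) /Ldiff /= !quot_map_pi -[RHS](linear0 (@qpi _ _ (ksub i))).
by congr (qpi _); exact: kdiffK.
Qed.

Definition Lcomplex : chain_complex A := ChainComplex LdiffK.

Definition Lhomology i : lmodType A := homology Lcomplex i.

End LComplex.

Section InitialFormSequences.
Variables (A : comNzRingType) (q : ideal A) (M : lmodType A).
Variables (d : nat) (a : 'I_d -> A) (c : 'I_d -> nat).
Hypothesis ha : forall i, has_order q (a i) (c i).
Variables (t : nat) (b : 'I_t -> A) (beta : 'I_t -> nat).
Hypothesis hb : forall j, has_order q (b j) (beta j).

(* b_1^*, ..., b_t^* is a G_M(q)-regular sequence in the ideal a^* G_A(q).    *)
Definition regular_init_forms_in : Prop :=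
  (forall j, ideal_gen (fun i => init_form (ha i)) (init_form (hb j))) /\
  regular_seq (gr_mod q M) (fun j => init_form (hb j)).

(* Lifting an expression of b_j^* as a homogeneous combination of the a_i^*   *)
(* gives b_j = sum_i r_i a_i with r_i in q^(beta_j - c_i). For the formula    *)
(* for L_(d-t) this is needed beyond (b)A being contained in (a)A: in         *)
(* k[[x, y]], with q = (x, y), a = (x y, x^2 + y^5), M = A, t = 1, the        *)
(* elements b = x^2 a_2 and b' = x^2 a_2 + y^6 of (a)A have the same initial  *)
(* form x^4, but for n >= 6 top_quotient below has length 3 = length L_1      *)
(* for b and length 2 for b'.                                                *)
Definition graded_lift : Prop := forall j,
  exists r : 'I_d -> A,
    (forall i, idpowz q ((beta j)%:Z - (c i)%:Z) (r i)) /\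
    b j = \sum_i r i * a i.

(* (b, q^k) M *)
Definition gen_filt (k : int) : submodule M :=
  submod_add (ideal_mul (ideal_gen b) (full_sub M)) (filt q M k).

Definition top_quotient (n : nat) : lmodType A :=
  let B := (\sum_j beta j)%N in
  subquotient
    (submod_bigcap (fun i : 'I_d =>
       colon (gen_filt ((n + B)%N%:Z - (\sum_(k | k != i) c k)%N%:Z)) (a i)))
    (gen_filt ((n + B)%N%:Z - (\sum_i c i)%N%:Z)).

End InitialFormSequences.

(* Main.v *)
Require Import Defs.
From mathcomp Require Import all_boot all_algebra.
From HB Require Import structures.
From mathcomp Require Import all_order boolp.

(** The complex L(n) is the Koszul complex of a on M modulo its part of
    filtration n. Its cycles are the Koszul chains x with D x in filtration n, its
    boundaries the chains equal to some D y up to filtration n. So only a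
    filtration of M enters, and dividing M by (b_j, j < k) M amounts to replacing
    q^n M by q^n M + (b_j, j < k) M, with the same Koszul chains. Initial forms
    b_1, ..., b_t form a regular sequence if and only if each b_k is strict for
    the filtration modulo its predecessors: if b_k x is in step n then x is in step
    n - beta_k ([regular_strict]).

    The main tool is a homotopy. If b is a sum of r_i a_i with r_i in
    q^(beta - c_i), then the wedge product h with the sum of r_i e_i raises the
    filtration by beta, and D h + h D = b. So b acts as 0 on homology, and if b is
    strict, h identifies the homology in degree i with that modulo b in degree
    i + 1, as soon as the homology in degree i + 1 vanishes ([thomology_shift]).
    There are no chains in degrees above d; going down from there, t divisions
    give the vanishing in degrees above d - t, and then move the homology in
    degree d - t to the top degree d, where it is the quotient of the intersection
    of colon modules ([thomology_bfil], [thomology_top]). The case b = a is the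
    implication from (a) to (c) in (1).

    From (b) to (a): the first homology vanishes if all relations among the a_i
    modulo q^n M come from Koszul relations. This passes from a_1, ..., a_k to
    a_1, ..., a_(k-1), by induction on n as c_k > 0 ([trivial_syzygies_pred]), and
    applied to relations with last coefficient x it says that a_k is strict.

    For the converse in (2), vanishing in degree d says that no nonzero
    homogeneous element of the graded module is killed by all the a_i. The graded
    module has finitely many maximal annihilators, which are primes, because the
    Rees algebra is noetherian ([graded_fg]). Prime avoidance then gives a strict
    homogeneous combination b of the a_i ([strict_exists]); modulo b the vanishing
    range shrinks by one degree ([tacyclic_quot]), so this can be done t times. *)

Set Implicit Arguments.
Unset Strict Implicit.
Unset Printing Implicit Defensive.

Import Order.TTheory GRing.Theory Num.Theory.
Local Open Scope ring_scope.

(** * Spans and finite generation *)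
Section Spans.
Variables (R : pzRingType).
Implicit Types (U V : lmodType R).

Lemma submod_eq V (N P : submodule V) : (forall x, N x <-> P x) -> N = P.
Proof.
case: N P => [N N0 NL] [P P0 PL] /= NP.
have eNP : N = P by apply: funext => x; apply: propext.
case: _ / eNP P0 PL {NP} => P0 PL.
by congr Submodule; apply: Prop_irrelevance.
Qed.

Lemma span_mem V (S : V -> Prop) y : S y -> submod_span S y.
Proof. by move=> Sy N; apply. Qed.

Lemma span_sub V (S : V -> Prop) (N : submodule V) :
  (forall y, S y -> N y) -> forall x, submod_span S x -> N x.
Proof. by move=> SN x; apply. Qed.

Lemma span_mono V (S T : V -> Prop) :
  (forall y, S y -> T y) -> forall x, submod_span S x -> submod_span T x.
Proof. by move=> ST; apply: span_sub => y /ST; apply: span_mem. Qed.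

(** Finite choice along a list, which keeps both the origin of each chosen
    element and the coverage of the list. *)
Lemma seq_choice (S T : eqType) (Q : S -> T -> Prop) (s : seq S) :
  (forall x, x \in s -> exists y, Q x y) ->
  exists l : seq T, (forall y, y \in l -> exists2 x, x \in s & Q x y) /\
    (forall x, x \in s -> exists2 y, y \in l & Q x y).
Proof.
elim: s => [|x s IH] hs; first by exists [::].
have [z zs|l [h1 h2]] := IH; first by apply: hs; rewrite inE zs orbT.
have [|y xy] := hs x; first exact: mem_head.
exists (y :: l); split=> z; rewrite inE => /predU1P[->|].
- by exists x => //; apply: mem_head.
- by move=> /h1[w ws wz]; exists w => //; rewrite inE ws orbT.
- by exists y => //; apply: mem_head.
- by move=> /h2[w wl zw]; exists w => //; rewrite inE wl orbT.
Qed.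

Lemma fg_span V (N : submodule V) : finitely_generated N ->
  exists2 s : seq V, (forall x, x \in s -> N x) &
    forall x, N x -> submod_span (fun y => y \in s) x.
Proof.
move=> [s hs]; exists s => x; last by move/hs.
by move=> xs; apply/hs; apply: span_mem.
Qed.

Lemma span_fg V (N : submodule V) (s : seq V) :
  (forall x, x \in s -> N x) ->
  (forall x, N x -> submod_span (fun y => y \in s) x) -> finitely_generated N.
Proof. by move=> h1 h2; exists s => x; split=> [/h2 //|]; apply: span_sub. Qed.

(** Every element of a span needs only finitely many of the spanning elements,
    so a finitely generated span is already spanned by finitely many of them. *)
Lemma fin_span V (S : V -> Prop) : finitely_generated (submod_span S) ->
  exists2 l : seq V, (forall y, y \in l -> S y) &
    forall x, submod_span S x -> submod_span (fun y => y \in l) x.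
Proof.
move=> /fg_span[s sS Ss].
have fin x : submod_span S x -> exists2 l : seq V, (forall y, y \in l -> S y) &
    submod_span (fun y => y \in l) x.
  pose P x := exists2 l : seq V, (forall y, y \in l -> S y) &
    submod_span (fun y => y \in l) x.
  have P0 : P 0 by exists [::] => //; apply: smem0.
  have PL b y z : P y -> P z -> P (b *: y + z).
    move=> [l lS ly] [l' lS' lz]; exists (l ++ l').
      by move=> w; rewrite mem_cat => /orP[/lS|/lS'].
    apply: smem_lin; [move: ly|move: lz]; apply: span_mono => w wl;
      by rewrite mem_cat wl ?orbT.
  apply: (span_sub (N := Submodule P0 PL)) => y Sy.
  by exists [:: y] => [z|]; [rewrite inE => /eqP->|apply: span_mem; rewrite inE].
suff [l lS sl] : exists2 l : seq V, (forall y, y \in l -> S y) &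
    forall x, x \in s -> submod_span (fun y => y \in l) x.
  by exists l => // x /Ss; apply: span_sub.
elim: s sS {Ss} => [|x s IH] sS; first by exists [::].
have [z zs|l lS ls] := IH; first by apply: sS; rewrite inE zs orbT.
have [|l' lS' lx] := fin x; first by apply: sS; apply: mem_head.
exists (l ++ l'); first by move=> w; rewrite mem_cat => /orP[/lS|/lS'].
move=> z; rewrite inE => /predU1P[->|/ls]; [move: lx|];
  by apply: span_mono => w wl; rewrite mem_cat wl ?orbT.
Qed.

End Spans.

Section FinGenNoeth.
Variables (R : comPzRingType) (hR : noetherian R) (V : lmodType R).

(** Induction on the number of generators: the coefficients that one
    generator v takes in N form an ideal, and the elements of N where v can be
    omitted are covered by the induction hypothesis. *)
Lemma noeth_sub (s : seq V) (N : submodule V) :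
  (forall x, N x -> submod_span (fun y => y \in s) x) -> finitely_generated N.
Proof.
elim: s N => [|v s IH] N Ns.
  by apply: (span_fg (s := [::])).
pose Sp := submod_span (fun y : V => y \in s).
pose P (a : R^o) := exists2 n, N n & Sp (n - a *: v).
have P0 : P 0 by exists 0; rewrite ?scale0r ?subr0; apply: smem0.
have PL b y z : P y -> P z -> P (b *: y + z).
  move=> [n Nn yn] [n' Nn' zn']; exists (b *: n + n'); first exact: smem_lin.
  rewrite scalerDl opprD addrACA -scalerA -scalerBr; exact: smem_lin.
have [as_ asP Pas] := fg_span (hR (Submodule P0 PL)).
have [|l [lP Pl]] := @seq_choice _ _ (fun a n => N n /\ Sp (n - a *: v)) as_.
  by move=> a /asP[n Nn Sn]; exists n.
pose N0P x := N x /\ Sp x.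
have N00 : N0P 0 by split; apply: smem0.
have N0L b y z : N0P y -> N0P z -> N0P (b *: y + z).
  by move=> [? ?] [? ?]; split; apply: smem_lin.
have [l0 l0N Nl0] := fg_span (IH (Submodule N00 N0L) (fun x h => h.2)).
apply: (span_fg (s := l ++ l0)) => x.
  by rewrite mem_cat => /orP[/lP[a _ []//]|/l0N[]].
move=> Nx.
have [a ax] : exists a, Sp (x - a *: v).
  pose Q y := exists a : R, Sp (y - a *: v).
  have Q0 : Q 0 by exists 0; rewrite scale0r subr0; apply: smem0.
  have QL b y z : Q y -> Q z -> Q (b *: y + z).
    move=> [e ye] [f zf]; exists (b * e + f).
    rewrite scalerDl opprD addrACA -scalerA -scalerBr; exact: smem_lin.
  apply: (span_sub (N := Submodule Q0 QL)) (Ns _ Nx) => y.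
  rewrite inE => /predU1P[->|ys].
    by exists 1; rewrite scale1r subrr; apply: smem0.
  by exists 0; rewrite scale0r subr0; apply: span_mem.
have [n [ln Nn Sn]] : exists n, [/\ submod_span (fun y => y \in l) n, N n &
    Sp (n - a *: v)].
  pose Q (e : R^o) := exists n, [/\ submod_span (fun y => y \in l) n, N n &
    Sp (n - e *: v)].
  have Q0 : Q 0 by exists 0; rewrite scale0r subr0; split; apply: smem0.
  have QL b y z : Q y -> Q z -> Q (b *: y + z).
    move=> [n [? ? yn]] [n' [? ? zn']]; exists (b *: n + n').
    split; try exact: smem_lin.
    rewrite scalerDl opprD addrACA -scalerA -scalerBr; exact: smem_lin.
  have Pa : Submodule P0 PL a by exists x.
  apply: (span_sub (N := Submodule Q0 QL)) (Pas _ Pa) => e /Pl[n nl [Nn Sn]].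
  by exists n; split=> //; apply: span_mem.
have /Nl0 xn0 : Submodule N00 N0L (x - n).
  split; first exact: smemB.
  have -> : x - n = (x - a *: v) - (n - a *: v) by rewrite opprB addrA subrK.
  exact: smemB.
rewrite -(subrK n x); apply: smemD; [move: xn0|move: ln];
  by apply: span_mono => w wl; rewrite mem_cat wl ?orbT.
Qed.

Lemma noeth_fg (N : submodule V) :
  finitely_generated (full_sub V) -> finitely_generated N.
Proof. by move=> [s hs]; apply: (@noeth_sub s) => x _; apply/hs. Qed.

End FinGenNoeth.

Lemma noetherian_surj (R S : comPzRingType) (f : {rmorphism R -> S}) :
  noetherian R -> (forall y, exists x, f x = y) -> noetherian S.
Proof.
move=> hR fs I.
pose P (x : R^o) := I (f x).
have P0 : P 0 by rewrite /P rmorph0; apply: smem0.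
have PL b y z : P y -> P z -> P (b *: y + z).
  by rewrite /P rmorphD rmorphM; apply: (@smem_lin _ S^o).
have [s sP Ps] := fg_span (hR (Submodule P0 PL)).
apply: (@span_fg S S^o I (map f s)) => y; first by move=> /mapP[x /sP Ix ->].
have [x <-] := fs y => /(Ps x).
pose Q (z : R^o) := submod_span (fun y : S^o => y \in map f s) (f z).
have Q0 : Q 0 by rewrite /Q rmorph0; apply: smem0.
have QL b u v : Q u -> Q v -> Q (b *: u + v).
  by rewrite /Q rmorphD rmorphM; apply: (@smem_lin _ S^o).
apply: (span_sub (N := Submodule Q0 QL)) => z zs.
by apply: span_mem; apply: map_f.
Qed.

(** * The basis theorem *)
Section Hilbert.
Variables (R : comNzRingType) (hR : noetherian R).
Implicit Types (p : {poly R}) (N : ideal {poly R}).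

Definition coef_pred N n (r : R^o) : Prop :=
  exists p, [/\ N p, (size p <= n.+1)%N & p`_n = r].

Fact coef_pred0 N n : coef_pred N n 0.
Proof.
by exists 0; split; rewrite ?size_poly0 ?coef0 //; apply: (@smem0 _ {poly R}^o).
Qed.

Fact coef_pred_lin N n (b : R) (y z : R^o) :
  coef_pred N n y -> coef_pred N n z -> coef_pred N n (b *: y + z).
Proof.
move=> [p [Np sp <-]] [p' [Np' sp' <-]]; exists (b%:P * p + p'); split.
- exact: (@smem_lin _ {poly R}^o).
- rewrite (leq_trans (size_polyD _ _)) // geq_max sp' andbT mul_polyC.
  exact: leq_trans (size_scale_leq _ _) sp.
- by rewrite coefD coefCM.
Qed.

(** Coefficients in degree n, so leading coefficients or 0, of the members of N
    of degree at most n. *)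
Definition lead_ideal N n : ideal R :=
  Submodule (coef_pred0 N n) (@coef_pred_lin N n).

Lemma lead_idealD N n k r : lead_ideal N n r -> lead_ideal N (k + n) r.
Proof.
move=> [p [Np sp <-]]; exists ('X^k * p).
split; first exact: (@smemZ _ {poly R}^o).
  by rewrite (leq_trans (size_polyMleq _ _)) // size_polyXn /= -addnS leq_add2l.
by rewrite coefXnM ltnNge leq_addr /= addKn.
Qed.

(** Subtracting a member of N' with the same leading coefficient lowers the
    degree; this is the step of the division in the basis theorem. *)
Lemma lead_reduce N N' n p : (forall x, N' x -> N x) ->
    lead_ideal N' n p`_n -> N p -> (size p <= n.+1)%N ->
  exists p', [/\ N' p', N (p - p') & (size (p - p')%R <= n)%N].
Proof.
move=> N'N [p' [N'p' sp' ep]] Np sp; exists p'; split=> //.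
  by apply: (@smemB _ {poly R}^o) => //; apply: N'N.
apply/leq_sizeP => j; rewrite leq_eqVlt => /predU1P[<-|nj].
  by rewrite coefB ep subrr.
by rewrite coefB !nth_default ?subrr // (leq_trans _ nj).
Qed.

Local Notation spanl l := (@submod_span _ {poly R}^o (fun y => y \in l)).

(** The leading coefficients of all members of I form a finitely generated
    ideal. Members realizing its generators reduce any polynomial of I of large
    degree, and the finitely many ideals [lead_ideal I n] with n small deal with
    the remaining degrees. *)
Theorem hilbert_basis : noetherian {poly R}.
Proof.
move=> I.
have low n : exists2 l : seq {poly R}, (forall p, p \in l -> I p) &
    forall p, I p -> (size p <= n)%N -> spanl l p.
  elim: n => [|n [l lI Il]].
    exists [::] => // p _; rewrite leqn0 size_poly_eq0 => /eqP->.
    exact: (@smem0 _ {poly R}^o).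
  have [rs rsP Prs] := fg_span (hR (lead_ideal I n)).
  have [l' [lP' Pl']] := seq_choice rsP.
  have lI' p : p \in l ++ l' -> I p.
    by rewrite mem_cat => /orP[/lI//|/lP'[r _ []]].
  exists (l ++ l') => // p Ip sp.
  have lp : lead_ideal (spanl (l ++ l')) n p`_n.
    apply: (span_sub _ (Prs _ _)); last by exists p.
    move=> r /Pl'[u ul [_ su <-]]; exists u; split=> //.
    by apply: span_mem; rewrite mem_cat ul orbT.
  have [p' [lp' Ip' sp']] :=
    lead_reduce (@span_sub _ {poly R}^o _ I lI') lp Ip sp.
  rewrite -(subrK p' p); apply: (@smemD _ {poly R}^o) => //.
  apply: (@span_mono _ {poly R}^o (fun y => y \in l)) (Il _ Ip' sp').
  by move=> w wl; rewrite mem_cat wl.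
pose P (r : R^o) := exists n, lead_ideal I n r.
have P0 : P 0 by exists 0%N; apply: (@smem0 _ R^o).
have PL b y z : P y -> P z -> P (b *: y + z).
  move=> [n yn] [k zk]; exists (n + k)%N; apply: (@smem_lin _ R^o).
    by rewrite addnC; apply: lead_idealD.
  exact: lead_idealD.
have [rs rsP Prs] := fg_span (hR (Submodule P0 PL)).
have [|l [lP Pl]] := @seq_choice _ _ (fun (r : R^o) (u : nat * {poly R}) =>
  [/\ I u.2, (size u.2 <= u.1.+1)%N & u.2`_(u.1) = r]) rs.
  by move=> r /rsP[n [p ?]]; exists (n, p).
pose N := (\max_(u <- l) u.1)%N.
have [l0 l0I Il0] := low N.
pose L := l0 ++ map snd l.
have LI p : p \in L -> I p.
  by rewrite mem_cat => /orP[/l0I//|/mapP[u /lP[r _ [? _ _]] ->]].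
apply: (@span_fg _ {poly R}^o I L) => // p Ip.
have [n] := ubnP (size p); elim: n p Ip => // n IH p Ip; rewrite ltnS => sp.
have [pN|Np] := leqP (size p) N.
  apply: (@span_mono _ {poly R}^o (fun y => y \in l0)) (Il0 _ Ip pN).
  by move=> w wl; rewrite mem_cat wl.
case esp: (size p) sp Np => [//|k] kn; rewrite ltnS => Nk.
have lp : lead_ideal (spanl L) k p`_k.
  apply: (span_sub _ (Prs _ _)); last by exists k, p; rewrite esp.
  move=> r /Pl[[e u] ul [/= Iu su <-]].
  rewrite -(@subnK e k); last first.
    by apply: leq_trans (leq_bigmax_seq (F := fst) _ ul isT) Nk.
  apply: lead_idealD; exists u; split=> //.
  by apply: span_mem; rewrite mem_cat (map_f snd ul) orbT.
have [|p' [lp' Ip' sp']] :=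
  lead_reduce (@span_sub _ {poly R}^o _ I LI) lp Ip; first by rewrite esp.
rewrite -(subrK p' p); apply: (@smemD _ {poly R}^o) => //.
by apply: IH => //; apply: leq_ltn_trans kn.
Qed.

End Hilbert.

(** * Filtrations compatible with the powers of an ideal *)
Section Filtrations.
Variables (A : comNzRingType) (q : ideal A).

Lemma idpowz_anti (i j : int) r : i <= j -> idpowz q j r -> idpowz q i r.
Proof.
case: i => [i|//]; case: j => [j|//]; rewrite lez_nat => ij.
exact: idpow_anti.
Qed.

Lemma ideal_mul_sub (M : lmodType A) (I : ideal A) (N P : submodule M) :
  (forall a x, I a -> N x -> P (a *: x)) -> forall x, ideal_mul I N x -> P x.
Proof. by move=> h; apply: span_sub => _ [a [x [Ia Nx ->]]]; apply: h. Qed.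

(** The indices are integers, with the whole module in degrees at most 0, so
    that the shifts n - c_i below never have to be truncated. *)
Record qfiltration (M : lmodType A) (G : int -> submodule M) : Prop :=
  QFiltration {
    qfilt_anti : forall i j x, i <= j -> G j x -> G i x;
    qfilt_mul : forall c k r x, idpow q c r -> G k x -> G (k + c%:Z) (r *: x);
    qfilt_full : forall k x, k <= 0 -> G k x }.

(** For negative k, idpowz q k is the whole ring and G (n + k) contains G n, so
    that one formula covers both signs. *)
Lemma qfilt_mulz M (G : int -> submodule M) k n r x : qfiltration G ->
  idpowz q k r -> G n x -> G (n + k) (r *: x).
Proof.
case: k => [k|k] GG /= kr nx; first exact: qfilt_mul.
apply: (qfilt_anti GG (j := n)); last exact: smemZ.
by rewrite gerDl NegzE oppr_le0.
Qed.

Lemma filt_qfiltration M : qfiltration (filt q M).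
Proof.
split=> [i j x ij||k x k0].
- apply: ideal_mul_sub => r y jr _; apply: ideal_mulE => //.
  exact: idpowz_anti jr.
- by move=> c k r x; apply: filt_scale.
rewrite -[x]scale1r; apply: ideal_mulE => //.
by case: k k0 => [[|k]|].
Qed.

Lemma filt_regular k r : filt q A^o k r <-> idpowz q k r.
Proof.
split=> [|kr]; last first.
  by have := @ideal_mulE A A^o _ (full_sub A^o) r 1 kr I; rewrite [_ *: _]mulr1.
apply: (@ideal_mul_sub A^o) => a x ka _; rewrite [_ *: _]mulrC.
exact: (@smemZ _ A^o).
Qed.

Lemma idpowz_mul k e r s :
  idpowz q k r -> idpow q e s -> idpowz q (k + e%:Z) (s * r).
Proof.
move=> /filt_regular kr es; apply/filt_regular.
exact: (qfilt_mul (filt_qfiltration A^o)).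
Qed.

Lemma idpow_exp e s n : idpow q e s -> idpow q (e * n) (s ^+ n).
Proof.
move=> es; elim: n => [|n IH]; first by rewrite muln0.
by rewrite exprS mulnS; apply: idpow_mul.
Qed.

End Filtrations.

(** * Finiteness of the Rees algebra and the Rees module *)
Section ReesNoetherian.
Variables (A : comNzRingType) (q : ideal A).

Fact rees_const_subproof (a : A) : a%:P \in reesb q.
Proof.
apply/asboolP => n; rewrite coefC; case: eqP => [->|_] //.
exact: (@smem0 _ A^o).
Qed.

Definition rees_const (a : A) : rees q := Rees (rees_const_subproof a).

Fact rees_const_zmod : zmod_morphism rees_const.
Proof. by move=> a b; apply: val_inj; rewrite /= polyCB. Qed.

Fact rees_const_monoid : monoid_morphism rees_const.
Proof.
by split=> [|a b]; apply: val_inj => //=; rewrite polyCM.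
Qed.

HB.instance Definition _ :=
  GRing.isZmodMorphism.Build A (rees q) rees_const rees_const_zmod.
HB.instance Definition _ :=
  GRing.isMonoidMorphism.Build A (rees q) rees_const rees_const_monoid.

(** Adjoining finitely many elements one at a time gives a polynomial ring over
    R mapping onto the subring that they generate. *)
Lemma noetherian_extension (R S : comNzRingType) (f : {rmorphism R -> S})
    (l : seq S) : noetherian R ->
  exists (P : comNzRingType) (g : {rmorphism P -> S}),
    [/\ noetherian P, forall r, exists p, g p = f r &
        forall y, y \in l -> exists p, g p = y].
Proof.
move=> hR; elim: l => [|y l [P [g [hP gR gl]]]].
  by exists R, f; split=> // r; exists r.
have cgy : commr_rmorph g y by move=> x; apply: mulrC.
exists {poly P}, (horner_morph cgy); split.
- exact: hilbert_basis.
- by move=> r; have [p <-] := gR r; exists p%:P; rewrite /= horner_morphC.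
move=> z; rewrite inE => /predU1P[->|/gl[p <-]].
  by exists 'X; rewrite /= horner_morphX.
by exists p%:P; rewrite /= horner_morphC.
Qed.

Definition rees_mono n (r : A) (h : idpow q n r) : rees q :=
  @Rees A q _ (rees_monomial h).

(** The Rees algebra is generated over A by x X, for x in a finite set of
    generators of q. *)
Theorem rees_noetherian : noetherian A -> noetherian (rees q).
Proof.
move=> hA; have [s sq qs] := fg_span (hA q).
have q1 x : q x -> idpow q 1 x.
  by move=> qx; rewrite -[x]mulr1; apply: (@ideal_mulE A A^o).
have [|l [lP sl]] := @seq_choice _ _ (fun (x : A) (y : rees q) =>
    val y = x *: 'X) s.
  by move=> x /sq/q1 xq; exists (rees_mono xq).
have [P [g [hP gA gl]]] := noetherian_extension rees_const l hA.
apply: (noetherian_surj (f := g)) => // y.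
pose im (z : rees q) := exists p, g p = z.
have im0 : im 0 by exists 0; rewrite rmorph0.
have imD u v : im u -> im v -> im (u + v).
  by move=> [p <-] [p' <-]; exists (p + p'); rewrite rmorphD.
have imM u v : im u -> im v -> im (u * v).
  by move=> [p <-] [p' <-]; exists (p * p'); rewrite rmorphM.
(* The monomials r X^n with r in q^n are products of constants and of the
   elements x X, x a generator of q. *)
have mono n r : idpow q n r -> exists2 z, im z & val z = r *: 'X^n.
  elim: n r => [|n IH] r.
    move=> _; have [p pr] := gA r; exists (rees_const r); first by exists p.
    by rewrite /= expr0 alg_polyC.
  pose Q m (r : A^o) := exists2 z, im z & val z = r *: 'X^m.
  have Q0 m : Q m 0 by exists 0 => //; rewrite scale0r.
  have QL m b u v : Q m u -> Q m v -> Q m (b *: u + v).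
    move=> [z iz ez] [w iw ew]; exists (rees_const b * z + w).
      by apply: imD => //; apply: imM => //; have [p pb] := gA b; exists p.
    by rewrite /= ez ew scalerDl -scalerA mul_polyC.
  apply: (ideal_mul_sub (P := Submodule (Q0 _) (QL _))) => x u qx /IH[w iw ew].
  have [z iz ez] : Q 1%N x.
    apply: (span_sub (N := Submodule (Q0 _) (QL _))) (qs _ qx) => v.
    by move=> /sl[z /gl[p pz] ez]; exists z => //; exists p.
  exists (z * w); first exact: imM.
  by rewrite /= ez ew -scalerAl -scalerAr scalerA -exprD.
have part n : exists2 z, im z & val z = \sum_(i < n) (val y)`_i *: 'X^i.
  elim: n => [|n [z iz ez]]; first by exists 0; rewrite ?big_ord0.
  have /asboolP/(_ n)/mono[w iw ew] := valP y.
  by exists (z + w); [apply: imD|rewrite big_ord_recr /= ez ew].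
have [z [p <-] ez] := part (size (val y)).
by exists p; apply: val_inj; rewrite ez -poly_def coefK.
Qed.

Variable M : lmodType A.

HB.instance Definition _ := GRing.Zmodule_isLmodule.Build (rees q) (reesm q M)
  (@rees_actA A q M) (@rees_act1 A q M) (@rees_actDr A q M) (@rees_actDl A q M).

Definition mseq (k : nat) (x : M) : nat -> M := fun n => if n == k then x else 0.

Fact mseq_reesm k x : filt q M k%:Z x -> mseq k x \in reesmb q (M := M).
Proof.
move=> kx; apply/asboolP; split=> [n|].
  by rewrite /mseq; case: eqP => [->|_] //; apply: smem0.
by exists k.+1 => n kn; rewrite /mseq gtn_eqF.
Qed.

Definition reesm_mono k x (h : filt q M k%:Z x) : reesm q M :=
  Reesm (mseq_reesm h).

Lemma conv_mono (r : A) j (x : nat -> M) n :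
  conv (r *: 'X^j) x n = if (j <= n)%N then r *: x (n - j)%N else 0.
Proof.
rewrite /conv; case: ifPn => jn.
  have jn1 : (j < n.+1)%N by [].
  rewrite (bigD1 (Ordinal jn1)) //= coefZ coefXn eqxx mulr1 big1 ?addr0 // => i.
  by rewrite -val_eqE /= coefZ coefXn => /negPf->; rewrite mulr0 scale0r.
apply: big1 => i _; rewrite coefZ coefXn; case: eqP => [ij|_].
  by case/negP: jn; rewrite -ij -ltnS.
by rewrite mulr0 scale0r.
Qed.

(** Generators of M, placed in degree 0, generate the Rees module, since
    its part of degree n is q^n M. *)
Theorem reesm_fg : finitely_generated (full_sub M) ->
  finitely_generated (full_sub (reesm q M)).
Proof.
move=> /fg_span[s _ sM].
have f0 x : filt q M 0%:Z x by apply: (qfilt_full (filt_qfiltration q M)).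
pose l := [seq reesm_mono (f0 x) | x <- s].
apply: (span_fg (s := l)) => // y _.
pose Sl := submod_span (fun z => z \in l).
pose Q n x := exists2 z, Sl z & val z = mseq n x.
have Q0 n : Q n 0.
  exists 0; first exact: smem0.
  by apply: funext => k; rewrite /mseq if_same.
have QL n b u v : Q n u -> Q n v -> Q n (b *: u + v).
  move=> [z iz ez] [w iw ew]; exists (rees_const b *: z + w).
    exact: smem_lin.
  apply: funext => k.
  rewrite (_ : val _ k = conv (b%:P) (val z) k + val w k) // ez ew.
  have := conv_mono b 0 (mseq n u) k; rewrite expr0 alg_polyC subn0 => -> /=.
  rewrite /mseq.
  by case: eqP => // _; rewrite scaler0 addr0.
have low x : Q 0%N x.
  apply: (span_sub (N := Submodule (Q0 _) (QL _))) (sM x I) => v vs.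
  by exists (reesm_mono (f0 v)) => //; apply: span_mem; apply: map_f.
have mono n x : filt q M n%:Z x -> Q n x.
  apply: (ideal_mul_sub (P := Submodule (Q0 n) (QL n))) => r v nr _.
  have [z iz ez] := low v; exists (rees_mono nr *: z); first exact: smemZ.
  apply: funext => k.
  transitivity (if (n <= k)%N then r *: val z (k - n)%N else 0).
    exact: conv_mono.
  rewrite ez /mseq.
  have [nk|kn] := leqP n k; last by rewrite ltn_eqF.
  by rewrite subn_eq0 eqn_leq nk andbT; case: ifP; rewrite ?scaler0.
have /asboolP[yF [N yN]] := valP y.
have [z iz ez] : exists2 z, Sl z &
    forall k, val z k = if (k < N)%N then val y k else 0.
  elim: N {yN} => [|N [z iz ez]]; first by exists 0 => //; apply: smem0.
  have [w iw ew] := mono _ _ (yF N); exists (z + w); first exact: smemD.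
  move=> k; rewrite (_ : val _ k = val z k + val w k) // ez ew /mseq ltnS.
  by case: ltngtP => [_|_|->]; rewrite ?addr0 ?add0r.
suff -> : y = z by [].
apply: val_inj; apply: funext => k; rewrite ez.
by case: ltnP => // /yN.
Qed.

(** Noetherianity of the Rees module, in terms of homogeneous elements only: a
    set S of such elements lies in the graded submodule generated by finitely
    many of them. Graded submodules are represented by their families of
    components W, and generation by quantifying over all such families. *)
Theorem graded_fg : noetherian A -> finitely_generated (full_sub M) ->
  forall S : nat -> M -> Prop, (forall k x, S k x -> filt q M k%:Z x) ->
  exists2 l : seq (nat * M), (forall u, u \in l -> S u.1 u.2) &
    forall W : nat -> submodule M,
      (forall n j r x, idpow q j r -> W n x -> W (n + j)%N (r *: x)) ->
      (forall u, u \in l -> W u.1 u.2) -> forall k x, S k x -> W k x.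
Proof.
move=> hA hM S SF.
pose T (z : reesm q M) := exists k x, S k x /\ val z = mseq k x.
have [l lT Tl] :=
  fin_span (noeth_fg (rees_noetherian hA) (submod_span T) (reesm_fg hM)).
have [|s [sS ls]] := @seq_choice _ _ (fun (z : reesm q M) (u : nat * M) =>
    S u.1 u.2 /\ val z = mseq u.1 u.2) l.
  by move=> z /lT[k [x kx]]; exists (k, x).
exists s => [u /sS[z _ []]//|W WZ sW k x kx].
pose Q (z : reesm q M) := forall n, W n (val z n).
have Q0 : Q 0 by move=> n; apply: smem0.
have QL p u v : Q u -> Q v -> Q (p *: u + v).
  move=> hu hv n; apply: smemD (hv n); apply: smem_sum => j _ /=.
  have jn : (j <= n)%N by rewrite -ltnS.
  rewrite -[X in W X](subnK jn); apply: WZ => //.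
  by have /asboolP := valP p; apply.
have Tx : T (reesm_mono (SF _ _ kx)) by exists k, x.
suff /(_ k) : Submodule Q0 QL (reesm_mono (SF _ _ kx)).
  by rewrite /= /mseq eqxx.
apply: (span_sub _ (Tl _ (span_mem Tx))) => z /ls[u us [_ ez]] n /=.
rewrite ez /mseq; case: eqP => [->|_]; [exact: sW|exact: smem0].
Qed.

End ReesNoetherian.

(** * Homogeneous prime avoidance *)
Section PrimeAvoidance.
Variables (A : comNzRingType) (q : ideal A) (M : lmodType A).
Variables (G : int -> submodule M) (GG : qfiltration q G).

(** Strictness of multiplication by b, as a map of degree beta of filtered
    modules. On the associated graded module it is injectivity of the initial
    form, by [strict_homog]. *)
Definition strict (b : A) (beta : nat) : Prop :=
  forall n x, G n (b *: x) -> G (n - beta%:Z) x.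

(** Every element has degree at least 0, so that injectivity in each degree
    pushes x up one step at a time. *)
Lemma strict_homog b beta :
  (forall (n : nat) x, G n%:Z x -> G (n + beta).+1%:Z (b *: x) -> G n.+1%:Z x) ->
  strict b beta.
Proof.
move=> hb n x nx.
have step (j : nat) : (j%:Z <= n - beta%:Z) -> G j%:Z x.
  elim: j => [|j IH] jn; first exact: (qfilt_full GG).
  have jn1 : (j + beta).+1%:Z <= n.
    by rewrite -addSn PoszD -lerBrDr.
  apply: hb; first by apply: IH; apply: le_trans jn; rewrite lez_nat.
  exact: (qfilt_anti GG jn1).
case e: (n - beta%:Z) => [j|j]; last exact: (qfilt_full GG).
by apply: step; rewrite e.
Qed.

(** A pair (k, x) with x in q^k M stands for the class of x in degree k of the
    graded module of G; hann is the degree n part of its annihilator. *)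
Definition hann (u : nat * M) (n : nat) (r : A) : Prop :=
  idpow q n r /\ G (u.1 + n).+1%:Z (r *: u.2).

Definition hnz (u : nat * M) : Prop :=
  filt q M u.1%:Z u.2 /\ ~ G u.1.+1%:Z u.2.

Definition hann_le (u v : nat * M) : Prop :=
  forall n r, hann u n r -> hann v n r.

Definition maxann (u : nat * M) : Prop :=
  hnz u /\ forall v, hnz v -> hann_le u v -> hann_le v u.

Lemma hann_mul u n m r s : hann u n r -> idpow q m s -> hann u (n + m) (s * r).
Proof.
move=> [nr kr] ms; split; first by rewrite addnC; apply: idpow_mul.
have := qfilt_mul GG ms kr.
by rewrite scalerA -PoszD addSn addnA.
Qed.

Lemma hann1 u : hnz u -> ~ hann u 0 1.
Proof. by move=> [_ nz] [_]; rewrite scale1r addn0. Qed.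

(** The usual argument: if s does not kill x, then the annihilator of s x
    contains that of x, hence is equal to it by maximality. *)
Lemma maxann_prime u n m r s : maxann u -> idpow q n r -> idpow q m s ->
  hann u (n + m) (r * s) -> hann u n r \/ hann u m s.
Proof.
case: u => k x [[/= kx nx] mx] nr ms [_ rs].
have [|nsx] := EM (hann (k, x) m s); first by right.
left; have nzv : hnz ((k + m)%N, s *: x).
  split; first exact: (filt_scale (k := k%:Z) ms kx).
  by move=> h; apply: nsx.
apply: (mx _ nzv); last first.
  by split=> //=; rewrite scalerA -addnA [(m + n)%N]addnC.
move=> e t [et kt]; split=> //=; have := qfilt_mul GG ms kt.
by rewrite !scalerA mulrC -PoszD /= addSn addnAC.
Qed.

Lemma maxann_exp u e s n : maxann u -> idpow q e s ->
  hann u (e * n) (s ^+ n) -> hann u e s.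
Proof.
move=> mu es; elim: n => [|n IH]; first by rewrite muln0 => /(hann1 mu.1).
rewrite exprS mulnS => /(maxann_prime mu es (idpow_exp n es)).
by case.
Qed.

(** A product of elements outside a prime ideal stays outside, so the prime
    annihilator of u does not contain an intersection of annihilators unless it
    contains one of them. *)
Lemma prime_separation u (l : seq (nat * M)) : maxann u ->
  (forall v, v \in l -> ~ hann_le v u) ->
  exists e s, [/\ idpow q e s, ~ hann u e s & forall v, v \in l -> hann v e s].
Proof.
move=> mu; elim: l => [|v l IH] lu.
  by exists 0%N, 1; split=> //; apply: hann1 mu.1.
have [w wl|e [s [es us ls]]] := IH; first by apply: lu; rewrite inE wl orbT.
have [n [r [vr ur]]] : exists n r, hann v n r /\ ~ hann u n r.
  have /existsNP[n /existsNP[r /not_implyP h]] := lu v (mem_head _ _).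
  by exists n, r.
exists (n + e)%N, (r * s); split.
- by apply: idpow_mul => //; exact: vr.1.
- by move=> /(maxann_prime mu vr.1 es)[].
move=> w; rewrite inE => /predU1P[->|/ls ws].
  by rewrite mulrC; apply: hann_mul.
by rewrite addnC; apply: hann_mul => //; exact: vr.1.
Qed.

Hypothesis hA : noetherian A.

Lemma hann_submodule u n : exists N : submodule A^o,
  forall r, N r <-> G (u.1 + n).+1%:Z (r *: u.2).
Proof.
have P0 : G (u.1 + n).+1%:Z ((0 : A^o) *: u.2) by rewrite scale0r; apply: smem0.
have PL (b : A) (y z : A^o) : G (u.1 + n).+1%:Z (y *: u.2) ->
    G (u.1 + n).+1%:Z (z *: u.2) -> G (u.1 + n).+1%:Z ((b *: y + z) *: u.2).
  by move=> hy hz; rewrite scalerDl -scalerA; apply: smem_lin.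
by exists (@Submodule A A^o (fun r => G (u.1 + n).+1%:Z (r *: u.2)) P0 PL).
Qed.

(** Ascending chain condition on homogeneous ideals. *)
Lemma maxann_exists u : hnz u -> exists2 v, maxann v & hann_le u v.
Proof.
move=> nzu; apply: contrapT => no.
pose T := {v | hnz v /\ hann_le u v}.
have next (v : T) : exists w : T, ~ hann_le (sval w) (sval v) /\
    hann_le (sval v) (sval w).
  case: v => v [nzv uv] /=; apply: contrapT => nw; apply: no.
  exists v => //; split=> // w nzw vw; apply: contrapT => wv; apply: nw.
  by exists (exist _ w (conj nzw (fun n r h => vw _ _ (uv n r h)))).
have {next} [f fP] := choice next.
pose v i := sval (iter i f (exist _ u (conj nzu (fun n r h => h)))).
have vle i j : (i <= j)%N -> hann_le (v i) (v j).
  move=> /subnK<-; elim: (j - i)%N => [//|k IH] n r /IH.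
  exact: (fP _).2.
have vnz i : hnz (v i) := (svalP (iter i f _)).1.
(* The union of the strictly increasing annihilators v i is finitely generated
   in the graded sense, hence already equal to one of them. *)
have [| |l lS lW] :=
  @graded_fg A q A^o hA _ (fun n r => exists i, hann (v i) n r).
- have [s _ hs] := fg_span (hA (full_sub A^o)).
  by apply: (@span_fg _ A^o _ s).
- by move=> n r [i [nr _]]; apply/filt_regular.
have [i li] : exists i, forall w, w \in l -> hann (v i) w.1 w.2.
  elim: l lS {lW} => [|w l IH] lS; first by exists 0%N.
  have [w' wl|i li] := IH; first by apply: lS; rewrite inE wl orbT.
  have [j wj] := lS w (mem_head _ _).
  exists (maxn i j) => w'; rewrite inE => /predU1P[->|/li].
    by apply: vle wj; apply: leq_maxr.
  by apply: vle; apply: leq_maxl.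
have [W hW] := choice (hann_submodule (v i)).
apply: ((fP (iter i f (exist _ u (conj nzu (fun n r h => h))))).1) => n r nr.
split; first exact: nr.1.
apply/hW; apply: lW; last by exists i.+1.
- move=> m j y x jy /hW mx; apply/hW.
  by have := qfilt_mul GG jy mx; rewrite -PoszD scalerA addSn addnA.
- by move=> w /li[_ ?]; apply/hW.
Qed.

Hypothesis hM : finitely_generated (full_sub M).

(** Finitely many elements with maximal annihilator generate all of them. If u
    is generated by the elements v, then the intersection of their annihilators
    is contained in that of u, and by [prime_separation] so is one of them. *)
Lemma maxann_finite : exists2 l : seq (nat * M),
  (forall v, v \in l -> maxann v) &
  forall u, maxann u -> exists2 v, v \in l & hann_le v u.
Proof.
have [|l lmax lW] := @graded_fg A q M hA hM (fun k x => maxann (k, x)).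
  by move=> k x [[]].
exists l => [[k x] /lmax //|[k x] mu].
apply: contrapT => no.
have [v vl|e [s [es nus ls]]] := @prime_separation _ l mu.
  by move=> vu; apply: no; exists v.
have P0 n : G (n + e).+1%:Z (s *: 0) by rewrite scaler0; apply: smem0.
have PL n (b : A) (y z : M) : G (n + e).+1%:Z (s *: y) ->
    G (n + e).+1%:Z (s *: z) -> G (n + e).+1%:Z (s *: (b *: y + z)).
  move=> hy hz; rewrite scalerDr scalerA mulrC -scalerA; exact: smem_lin.
apply: nus; split=> //=.
apply: (lW (fun n => Submodule (P0 n) (PL n))) mu.
- move=> n j r y jr /= ny; have := qfilt_mul GG jr ny.
  by rewrite -PoszD !scalerA mulrC /= addSn addnAC.
- by move=> v /ls[].
Qed.

Variables (d : nat) (a : 'I_d -> A) (c : 'I_d -> nat).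
Hypothesis ca : forall i, idpow q (c i) (a i).
Hypothesis hc : forall i, (0 < c i)%N.

(** The element b is a combination of the a_i which is homogeneous of degree
    beta in the graded sense, rather than only an element of the ideal (a). *)
Definition homog_comb (b : A) (beta : nat) : Prop :=
  exists r : 'I_d -> A, (forall i, idpowz q (beta%:Z - (c i)%:Z) (r i)) /\
    b = \sum_i r i * a i.

Lemma homog_comb_gen i : homog_comb (a i) (c i).
Proof.
exists (fun j => if j == i then 1 else 0); split.
  move=> j; case: eqP => [->|_]; first by rewrite subrr.
  by exact: (@smem0 _ A^o).
rewrite (bigD1 i) //= eqxx mul1r big1 ?addr0 // => j /negPf->.
by rewrite mul0r.
Qed.

Lemma homog_combD b b' beta :
  homog_comb b beta -> homog_comb b' beta -> homog_comb (b + b') beta.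
Proof.
move=> [r [hr ->]] [r' [hr' ->]]; exists (fun i => r i + r' i); split.
  by move=> i; apply: (@smemD _ A^o).
by rewrite -big_split /=; apply: eq_bigr => i _; rewrite mulrDl.
Qed.

Lemma homog_combM b beta e s :
  homog_comb b beta -> idpow q e s -> homog_comb (s * b) (beta + e).
Proof.
move=> [r [hr ->]] es; exists (fun i => s * r i); split.
  by move=> i; rewrite PoszD addrAC; apply: idpowz_mul.
by rewrite big_distrr /=; apply: eq_bigr => i _; rewrite mulrA.
Qed.

Lemma homog_comb_idpow b beta : homog_comb b beta -> idpow q beta b.
Proof.
move=> [r [hr ->]]; apply: (@smem_sum _ A^o) => i _.
by have := idpowz_mul (hr i) (ca i); rewrite subrK mulrC.
Qed.

Lemma homog_combX b beta n : (0 < n)%N ->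
  homog_comb b beta -> homog_comb (b ^+ n) (beta * n).
Proof.
case: n => // n _ hb; rewrite exprSr mulnS; apply: homog_combM => //.
by apply: idpow_exp; apply: homog_comb_idpow.
Qed.

Hypothesis hJ : forall u, hnz u -> exists i, ~ hann u (c i) (a i).

(** Homogeneous prime avoidance. If b lies in the annihilator of u only, choose f
    in the annihilators of the others but not in that of u; powers bring b and f
    to a common degree and their sum avoids all. The initial forms a_i have
    positive degree, so all exponents used are positive. *)
Lemma prime_avoidance (i0 : 'I_d) (l : seq (nat * M)) :
  (forall v, v \in l -> maxann v) ->
  exists b beta, [/\ (0 < beta)%N, homog_comb b beta &
    forall v, v \in l -> ~ hann v beta b].
Proof.
elim: l => [|u l IH] lmax.
  by exists (a i0), (c i0); split=> //; apply: homog_comb_gen.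
have mu := lmax u (mem_head _ _).
have lmax' v : v \in l -> maxann v by move=> vl; apply: lmax; rewrite inE vl orbT.
have [b [beta [b0 hb lb]]] := IH lmax'.
have [ub|nub] := EM (hann u beta b); last first.
  by exists b, beta; split=> // v; rewrite inE => /predU1P[->|/lb].
have [v vl|e [s [es us ls]]] := @prime_separation u l mu.
  by move=> vu; apply: (lb v vl); apply: (lmax' v vl).2 ub => //; exact: mu.1.
have [i ui] := hJ mu.1.
have [e' e'E] : exists e', e' = (e + c i)%N by exists (e + c i)%N.
have e'0 : (0 < e')%N by rewrite e'E addn_gt0 hc orbT.
have [f [fE hf uf lf]] : exists f, [/\ idpow q e' f, homog_comb f e',
    ~ hann u e' f & forall v, v \in l -> hann v e' f].
  exists (s * a i); rewrite e'E; split.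
  - exact: idpow_mul.
  - by rewrite addnC; apply: homog_combM => //; apply: homog_comb_gen.
  - by move=> /(maxann_prime mu es (ca i))[].
  - by move=> v /ls vs; rewrite mulrC; apply: hann_mul.
have bE := homog_comb_idpow hb.
have annX w n g m : (0 < m)%N -> hann w n g -> hann w (n * m) (g ^+ m).
  case: m => // m _ wg; rewrite exprSr mulnS; apply: hann_mul => //.
  by apply: idpow_exp; exact: wg.1.
have annB w n g h : hann w n (g + h) -> hann w n h -> hann w n g.
  move=> [gh ?] [hh ?]; split; first by rewrite -(addrK h g); apply: (@smemB _ A^o).
  by rewrite -(addrK h g) scalerBl; apply: smemB.
exists (b ^+ e' + f ^+ beta), (beta * e')%N; split.
- by rewrite muln_gt0 b0.
- apply: homog_combD; first exact: homog_combX.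
  by rewrite mulnC; apply: homog_combX.
move=> v; rewrite inE => /predU1P[->|vl].
  rewrite addrC => /annB h; apply: uf; apply: (maxann_exp (n := beta) mu fE).
  by rewrite mulnC; apply: h; apply: annX.
move=> /annB h; apply: (lb v vl).
apply: (maxann_exp (n := e') (lmax' v vl) bE); apply: h.
by rewrite mulnC; apply: annX => //; apply: lf.
Qed.

Hypothesis hG : forall (n : nat) x, G n%:Z x ->
  exists2 v, filt q M n%:Z v & forall m, G m (x - v).

(** A zero divisor on the graded module lies in some maximal annihilator, so an
    element avoiding these is strict. *)
Theorem strict_exists (i0 : 'I_d) : exists b beta,
  homog_comb b beta /\ strict b beta.
Proof.
have [l lmax lfin] := maxann_finite.
have [b [beta [_ hb lb]]] := prime_avoidance i0 lmax.
exists b, beta; split=> //; apply: strict_homog => n x nx nbx.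
apply: contrapT => nnx; have [v nv xv] := hG nx.
have nzv : hnz (n, v).
  split=> //= n1v; apply: nnx.
  by rewrite -(subrK v x); apply: smemD.
have [u mu vu] := maxann_exists nzv; have [w wl wu] := lfin u mu.
apply: (lb w wl); apply: (lmax w wl).2 (vu _ _ _) => //; first exact: mu.1.
split; first exact: homog_comb_idpow.
rewrite /= -[v](subKr x) scalerBr; apply: smemB => //.
by apply: smemZ; apply: xv.
Qed.

End PrimeAvoidance.

(** * Isomorphisms of subquotients *)
Section Isomorphisms.
Variable R : pzRingType.
Implicit Types U V W : lmodType R.

Lemma lmod_iso_refl V : lmod_iso V V.
Proof. by exists idfun; exists idfun. Qed.

Lemma lmod_iso_sym U V : lmod_iso U V -> lmod_iso V U.
Proof.
move=> [f [g fK gK]].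
have gL : linear g := can2_linear fK gK.
pose gl : {linear V -> U} := HB.pack g (GRing.isLinear.Build R V U _ g gL).
by exists gl; exists f.
Qed.

Lemma lmod_iso_trans U V W : lmod_iso U V -> lmod_iso V W -> lmod_iso U W.
Proof.
move=> [f [f' fK f'K]] [g [g' gK g'K]]; exists (g \o f)%FUN.
by exists (f' \o g') => x /=; rewrite ?gK ?fK ?f'K ?g'K.
Qed.

Lemma lmod_iso_trivial U V : lmod_iso U V -> lmod_trivial V -> lmod_trivial U.
Proof.
by move=> [f [g fK _]] V0 x; rewrite -(fK x) (V0 (f x)) -(V0 (f 0)) fK.
Qed.

Lemma subquotient_trivial V (Z B : submodule V) :
  lmod_trivial (subquotient Z B) <-> forall x, Z x -> B x.
Proof.
split=> [h x Zx|ZB y].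
  have xZ : x \in smemb Z by apply/asboolP.
  have := h (qpi (submod_comap (\val : {linear sub_lmod Z -> V}) B) (SubLmod xZ)).
  by rewrite -[RHS](linear0 (@qpi _ _ _)) => /qpiP; rewrite subr0.
rewrite -(qreprK y) -[RHS](linear0 (@qpi _ _ _)); apply/qpiP; rewrite subr0.
by apply: ZB; apply/asboolP; apply: (valP (qrepr y)).
Qed.

(** The conditions say that f induces a bijection on classes; no inverse map
    has to be described on representatives. *)
Lemma subquotient_iso U V (Z B : submodule U) (Z' B' : submodule V)
    (f : {linear U -> V}) :
  (forall x, Z x -> Z' (f x)) ->
  (forall x, Z x -> (B' (f x) <-> B x)) ->
  (forall y, Z' y -> exists2 x, Z x & B' (y - f x)) ->
  lmod_iso (subquotient Z B) (subquotient Z' B').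
Proof.
move=> fZ fB fs.
have gP (x : sub_lmod Z) : f (val x) \in smemb Z'.
  by apply/asboolP/fZ/asboolP; exact: (valP x).
pose g (x : sub_lmod Z) : sub_lmod Z' := SubLmod (gP x).
have gL : linear g by move=> b x y; apply: val_inj; rewrite /= linearP.
pose gl : {linear sub_lmod Z -> sub_lmod Z'} :=
  HB.pack g (GRing.isLinear.Build R _ _ _ g gL).
pose N := submod_comap (\val : {linear sub_lmod Z -> U}) B.
pose P := submod_comap (\val : {linear sub_lmod Z' -> V}) B'.
have NP x : N x <-> P (gl x).
  by split=> /fB; apply; apply/asboolP; exact: (valP x).
pose h : {linear quot_lmod N -> quot_lmod P} := quot_map (fun x => (NP x).1).
have hpi x : h (qpi N x) = qpi P (gl x) by apply: quot_map_pi.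
have hinj : injective h.
  move=> x y; rewrite -(qreprK x) -(qreprK y) !hpi => /qpiP.
  by rewrite -linearB => /NP/qpiP.
have hsurj y : exists x, h x = y.
  rewrite -(qreprK y); set y' := qrepr y.
  have [|x Zx B'x] := fs (val y'); first by apply/asboolP; exact: (valP y').
  have xZ : x \in smemb Z by apply/asboolP.
  exists (qpi N (SubLmod xZ)); rewrite hpi; apply/qpiP.
  by rewrite -opprB; apply: smemN.
have [h' h'K] := choice hsurj.
by exists h, h' => // x; apply: hinj; rewrite h'K.
Qed.

End Isomorphisms.

(** * The Koszul complex *)
Section TotalKoszul.
Variables (A : comNzRingType) (M : lmodType A) (d : nat) (a : 'I_d -> A).

Local Notation tkoszul := {ffun {set 'I_d} -> M}.
Implicit Types (x y : tkoszul) (J : {set 'I_d}).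

Definition ksgn J (j : 'I_d) : A := (-1) ^+ below J j.

Lemma ksgnK J j : ksgn J j * ksgn J j = 1.
Proof. by rewrite /ksgn -expr2 sqrr_sign. Qed.

(** This sign rule is anticommutation of wedging with e_i and contracting by e_j,
    for distinct i and j. *)
Lemma ksgnU J i j : i \notin J -> j \notin J -> i != j ->
  ksgn (i |: J) j * ksgn (j |: J) i = - (ksgn J i * ksgn J j).
Proof.
move=> iJ jJ ij; rewrite /ksgn !belowU // -!exprD.
have [ij'|ji|/val_inj/eqP] := ltngtP i j; last by rewrite (negPf ij).
  by rewrite add0n add1n addSn exprS mulN1r addnC.
by rewrite add0n add1n addnS exprS mulN1r addnC.
Qed.

(** Chains of all degrees live in one module, the functions on all subsets of
    the index set. The differential then needs no case distinction in degree 0,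
    where it vanishes by itself. *)
Definition tdiff x : tkoszul :=
  [ffun J : {set _} => \sum_(j | j \notin J) ksgn J j *: (a j *: x (j |: J))].

Fact tdiff_linear : linear tdiff.
Proof.
move=> b x y; apply/ffunP => J; rewrite !ffunE scaler_sumr -big_split /=.
apply: eq_bigr => j _; rewrite !ffunE !scalerDr !scalerA.
by rewrite [_ * b]mulrC mulrA.
Qed.

HB.instance Definition _ :=
  GRing.isLinear.Build A tkoszul tkoszul _ tdiff tdiff_linear.

(** Left multiplication by e_i in the exterior algebra. *)
Definition twedge (i : 'I_d) x : tkoszul :=
  [ffun J : {set _} => if i \in J then ksgn (J :\ i) i *: x (J :\ i) else 0].

Fact twedge_linear i : linear (twedge i).
Proof.
move=> b x y; apply/ffunP => J; rewrite !ffunE.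
case: ifP => _; last by rewrite scaler0 addr0.
by rewrite scalerDr !scalerA mulrC.
Qed.

HB.instance Definition _ i :=
  GRing.isLinear.Build A tkoszul tkoszul _ (twedge i) (@twedge_linear i).

(** Contraction is a derivation and sends e_i to a_i. *)
Lemma twedge_homotopy i x : tdiff (twedge i x) + twedge i (tdiff x) = a i *: x.
Proof.
apply/ffunP => J; rewrite !ffunE; case: ifPn => iJ; last first.
  rewrite addr0 (bigD1 i) //= big1 ?addr0.
    rewrite ffunE setU11 setU1K // scalerA [_ * a i]mulrC -scalerA.
    by rewrite [X in _ *: X]scalerA ksgnK scale1r.
  move=> j /andP[jJ ji]; rewrite ffunE in_setU1 eq_sym (negPf ji) (negPf iJ).
  by rewrite !scaler0.
have iK : i \notin J :\ i by rewrite !inE eqxx.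
rewrite [X in _ + _ *: X](bigD1 i) //= setD1K // scalerDr.
rewrite [X in _ + (X + _)]scalerA ksgnK scale1r addrCA scaler_sumr.
rewrite [X in _ + X](_ : _ = 0) ?addr0 //.
have eqJ j : (j \notin J :\ i) && (j != i) = (j \notin J).
  by rewrite !inE negb_and negbK; case: (eqVneq j i) => [->|_]; rewrite ?iJ ?andbT.
rewrite [X in _ + X](eq_bigl _ _ eqJ) -big_split; apply: big1 => j jJ /=.
have ji : j != i by apply: contraNneq jJ => ->.
have jK : j \notin J :\ i by rewrite !inE negb_and jJ orbT.
rewrite ffunE !inE iJ orbT.
have -> : (j |: J) :\ i = j |: (J :\ i).
  by apply/setP => l; rewrite !inE; case: (eqVneq l j) => [->|]; rewrite ?ji.
rewrite [X in X + _](_ : _ =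
  (ksgn J j * ksgn (j |: J :\ i) i) *: (a j *: x (j |: J :\ i))); last first.
  by rewrite -scalerA; congr (_ *: _); rewrite !scalerA mulrC.
rewrite [X in _ + X]scalerA -{1}(setD1K iJ) ksgnU //; last by rewrite eq_sym.
by rewrite scaleNr addNr.
Qed.

Definition tdeg i x : Prop := forall J, #|J| != i -> x J = 0.

Lemma tdeg0 i : tdeg i 0.
Proof. by move=> J _; rewrite ffunE. Qed.

Lemma tdeg_lin i b x y : tdeg i x -> tdeg i y -> tdeg i (b *: x + y).
Proof. by move=> hx hy J Ji; rewrite !ffunE hx // hy // scaler0 addr0. Qed.

Definition tdeg_sub i : submodule tkoszul := Submodule (@tdeg0 i) (@tdeg_lin i).

Lemma tdeg_tdiff i x : tdeg i.+1 x -> tdeg i (tdiff x).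
Proof.
move=> hx J Ji; rewrite ffunE big1 // => j jJ.
by rewrite hx ?scaler0 // cardsU1 jJ.
Qed.

Lemma tdeg_tdiff0 x : tdeg 0 x -> tdiff x = 0.
Proof.
move=> hx; apply/ffunP => J; rewrite !ffunE big1 // => j jJ.
by rewrite hx ?scaler0 // cardsU1 jJ.
Qed.

Lemma tdeg_twedge i k x : tdeg i x -> tdeg i.+1 (twedge k x).
Proof.
move=> hx J Ji; rewrite ffunE; case: ifP => // kJ; rewrite hx ?scaler0 //.
by apply: contraNneq Ji => <-; rewrite (cardsD1 k J) kJ.
Qed.

Lemma tdeg_large i x : (d < i)%N -> tdeg i x -> x = 0.
Proof.
move=> di hx; apply/ffunP => J; rewrite ffunE hx // neq_ltn.
by rewrite (leq_ltn_trans (max_card _)) // card_ord.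
Qed.

Definition of_kchain i (x : kchain M d i) : tkoszul :=
  [ffun J : {set _} => kcoef x J].

Fact of_kchain_linear i : linear (@of_kchain i).
Proof.
by move=> b x y; apply/ffunP => J; rewrite !ffunE (kcoef_linear J b x y).
Qed.

HB.instance Definition _ i :=
  GRing.isLinear.Build A (kchain M d i) tkoszul _ (@of_kchain i)
    (@of_kchain_linear i).

Lemma tdeg_of_kchain i (x : kchain M d i) : tdeg i (of_kchain x).
Proof. by move=> J Ji; rewrite ffunE /kcoef insubF //; apply: negPf. Qed.

Lemma of_kchain_surj i x : tdeg i x -> exists y : kchain M d i, x = of_kchain y.
Proof.
move=> hx; exists [ffun J => x (val J)]; apply/ffunP => J.
rewrite ffunE /kcoef; case: insubP => [J' _ <-|/hx//]; by rewrite ffunE.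
Qed.

Lemma tdiff_of_kchain i (x : kchain M d i.+1) :
  tdiff (of_kchain x) = of_kchain (kdiff a x).
Proof.
apply/ffunP => J; rewrite [RHS]ffunE; case: (eqVneq #|J| i) => [Ji|Ji].
  by rewrite kcoef_kdiff // ffunE; apply: eq_bigr => j _; rewrite ffunE.
rewrite (tdeg_tdiff (@tdeg_of_kchain _ x) Ji).
by rewrite /kcoef insubF //; apply: negPf.
Qed.

Lemma tdiffK i x : tdeg i x -> tdiff (tdiff x) = 0.
Proof.
case: i => [|[|i]].
- by move=> /tdeg_tdiff0->; rewrite linear0.
- by move=> /tdeg_tdiff/tdeg_tdiff0.
move=> /of_kchain_surj[y ->].
by rewrite !tdiff_of_kchain kdiffK linear0.
Qed.

End TotalKoszul.

(** * Homology of the Koszul complex modulo a filtration *)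
Section FilteredKoszul.
Variables (A : comNzRingType) (q : ideal A) (M : lmodType A).
Variables (d : nat) (a : 'I_d -> A) (c : 'I_d -> nat).
Hypothesis ca : forall i, idpow q (c i) (a i).

Local Notation tkoszul := {ffun {set 'I_d} -> M}.
Implicit Types (x y : tkoszul) (J : {set 'I_d}) (G : int -> submodule M).

Definition weight J : int := (\sum_(j in J) c j)%N%:Z.

(** The subcomplex of filtration n: the basis vector e_J has weight the sum of
    the c_j, j in J. *)
Definition tfil G (n : int) x : Prop := forall J, G (n - weight J) (x J).

Lemma tfil0 G n : tfil G n 0.
Proof. by move=> J; rewrite ffunE; apply: smem0. Qed.

Lemma tfil_lin G n b x y : tfil G n x -> tfil G n y -> tfil G n (b *: x + y).
Proof. by move=> hx hy J; rewrite !ffunE; apply: smem_lin. Qed.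

Definition tfil_sub G n : submodule tkoszul :=
  Submodule (@tfil0 G n) (@tfil_lin G n).

Lemma weightU J j : j \notin J -> weight (j |: J) = (c j)%:Z + weight J.
Proof. by move=> jJ; rewrite /weight big_setU1. Qed.

Lemma tfil_tdiff G n x : qfiltration q G -> tfil G n x -> tfil G n (tdiff a x).
Proof.
move=> GG hx J; rewrite ffunE; apply: smem_sum => j jJ; apply: smemZ.
have := qfilt_mul GG (ca j) (hx (j |: J)).
by rewrite weightU // opprD addrA addrAC subrK.
Qed.

Lemma tfil_twedge G n k r i x : qfiltration q G ->
  idpowz q (k - (c i)%:Z) r -> tfil G n x -> tfil G (n + k) (r *: twedge i x).
Proof.
move=> GG kr hx J; rewrite !ffunE; case: ifPn => iJ; last first.
  by rewrite scaler0; apply: smem0.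
rewrite scalerA mulrC -scalerA; apply: smemZ.
have wJ : weight J = (c i)%:Z + weight (J :\ i).
  by rewrite -{1}(setD1K iJ) weightU ?setD11.
have := qfilt_mulz GG kr (hx (J :\ i)).
by rewrite wJ opprD !addrA [n - _ + k]addrAC [n + k - _ - _]addrAC.
Qed.

Definition tcycle_pred G i n x : Prop := tdeg i x /\ tfil G n (tdiff a x).
Definition tbound_pred G i n x : Prop :=
  exists2 y, tdeg i.+1 y & tfil G n (x - tdiff a y).

Fact tcycle0 G i n : tcycle_pred G i n 0.
Proof. by split; [apply: tdeg0|rewrite linear0; apply: tfil0]. Qed.

Fact tcycle_lin G i n b x y : tcycle_pred G i n x -> tcycle_pred G i n y ->
  tcycle_pred G i n (b *: x + y).
Proof.
by move=> [? ?] [? ?]; split; [apply: tdeg_lin|rewrite linearP; apply: tfil_lin].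
Qed.

Fact tbound0 G i n : tbound_pred G i n 0.
Proof. by exists 0; [apply: tdeg0|rewrite linear0 subr0; apply: tfil0]. Qed.

Fact tbound_lin G i n b x y : tbound_pred G i n x -> tbound_pred G i n y ->
  tbound_pred G i n (b *: x + y).
Proof.
move=> [u ? xu] [v ? yv]; exists (b *: u + v); first exact: tdeg_lin.
by rewrite linearP opprD addrACA -scalerBr; apply: tfil_lin.
Qed.

Definition tcycles G i n : submodule tkoszul :=
  Submodule (@tcycle0 G i n) (@tcycle_lin G i n).
Definition tbounds G i n : submodule tkoszul :=
  Submodule (@tbound0 G i n) (@tbound_lin G i n).
Definition thomology G i n : lmodType A :=
  subquotient (tcycles G i n) (tbounds G i n).

Definition tacyclic G i : Prop := forall n x, tcycles G i n x -> tbounds G i n x.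

End FilteredKoszul.

(** * Division by a strict element *)
Section QuotientFiltration.
Variables (A : comNzRingType) (q : ideal A) (M : lmodType A).
Variables (b : A) (G : int -> submodule M).

Fact quot_filt0 n : exists y, G n (0 - b *: y).
Proof. by exists 0; rewrite scaler0 subrr; apply: smem0. Qed.

Fact quot_filt_lin n e x x' : (exists y, G n (x - b *: y)) ->
  (exists y, G n (x' - b *: y)) -> exists y, G n (e *: x + x' - b *: y).
Proof.
move=> [y xy] [y' xy']; exists (e *: y + y').
rewrite scalerDr opprD addrACA scalerA mulrC -scalerA -scalerBr.
exact: smem_lin.
Qed.

(** The filtration induced on M / b M, pulled back to M. Working with preimages
    keeps M fixed while dividing by several elements in succession. *)
Definition quot_filt (n : int) : submodule M :=
  Submodule (quot_filt0 n) (@quot_filt_lin n).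

Lemma quot_filt_ge n x : G n x -> quot_filt n x.
Proof. by move=> nx; exists 0; rewrite scaler0 subr0. Qed.

End QuotientFiltration.

Section KoszulQuotient.
Variables (A : comNzRingType) (q : ideal A) (M : lmodType A).
Variables (d : nat) (a : 'I_d -> A) (c : 'I_d -> nat).
Hypothesis ca : forall i, idpow q (c i) (a i).
Variables (G : int -> submodule M) (GG : qfiltration q G).
Variables (b : A) (beta : nat).
Hypotheses (hb : homog_comb q a c b beta) (sb : strict G b beta).

Local Notation tkoszul := {ffun {set 'I_d} -> M}.
Implicit Types (x y : tkoszul) (J : {set 'I_d}).

Local Notation tfil G := (tfil c G).
Local Notation G' := (quot_filt b G).
Local Notation Z := (tcycles a c).
Local Notation B := (tbounds a c).

Lemma tfil_quot i n x : tdeg i x -> tfil G' n x ->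
  exists2 y, tdeg i y & tfil G n (x - b *: y).
Proof.
move=> hx xn; have [f fP] := choice xn.
exists [ffun J : {set _} => if #|J| == i then f J else 0].
  by move=> J /negPf Ji; rewrite ffunE Ji.
move=> J; rewrite !ffunE; case: eqP => [_ //|/eqP Ji].
by rewrite hx // scaler0 subrr; apply: smem0.
Qed.

Lemma tfil_quot_intro n x y : tfil G n (x - b *: y) -> tfil G' n x.
Proof. by move=> h J; exists (y J); have := h J; rewrite !ffunE. Qed.

Lemma tfil_scale n x : tfil G n x -> tfil G (n + beta%:Z) (b *: x).
Proof.
move=> h J; rewrite ffunE addrAC; apply: (qfilt_mul GG) => //.
exact: homog_comb_idpow hb.
Qed.

Lemma tfil_descale n x : tfil G (n + beta%:Z) (b *: x) -> tfil G n x.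
Proof.
move=> h J; have := h J; rewrite ffunE => /sb.
by rewrite addrAC addrK.
Qed.

(** Write b as the combination of r_i a_i; then h is the wedge product with the
    sum of r_i e_i. The condition on the degree of r_i is what makes h raise the
    filtration by beta. *)
Lemma homog_comb_homotopy : exists h : {linear tkoszul -> tkoszul},
  [/\ forall x, tdiff a (h x) + h (tdiff a x) = b *: x,
      forall i x, tdeg i x -> tdeg i.+1 (h x) &
      forall n x, tfil G n x -> tfil G (n + beta%:Z) (h x)].
Proof.
have [r [hr eb]] := hb.
pose h x := \sum_i r i *: twedge i x.
have hL : linear h.
  move=> e x y; rewrite /h scaler_sumr -big_split; apply: eq_bigr => i _ /=.
  by rewrite linearP scalerDr !scalerA mulrC.
pose hl : {linear tkoszul -> tkoszul} :=
  HB.pack h (GRing.isLinear.Build A _ _ _ h hL).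
exists hl; split=> [x|i x xi|n x xn].
- rewrite /= /h linear_sum -big_split /= eb scaler_suml; apply: eq_bigr => i _.
  by rewrite linearZ /= -scalerDr twedge_homotopy scalerA.
- apply: (@smem_sum _ _ (tdeg_sub M d i.+1)) => j _.
  by apply: (@smemZ _ _ (tdeg_sub M d i.+1)); apply: tdeg_twedge.
- apply: (@smem_sum _ _ (tfil_sub c G (n + beta%:Z))) => j _.
  exact: (tfil_twedge GG (hr j)).
Qed.

Let tfilD n x y : tfil G n x -> tfil G n y -> tfil G n (x + y).
Proof. exact: (@smemD _ _ (tfil_sub c G n)). Qed.
Let tfilB n x y : tfil G n x -> tfil G n y -> tfil G n (x - y).
Proof. exact: (@smemB _ _ (tfil_sub c G n)). Qed.
Let tfilN n x : tfil G n x -> tfil G n (- x).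
Proof. exact: (@smemN _ _ (tfil_sub c G n)). Qed.
Let tdegB i x y : tdeg i x -> tdeg i y -> tdeg i (x - y).
Proof. exact: (@smemB _ _ (tdeg_sub M d i)). Qed.
Let tdegZ i e x : tdeg i x -> tdeg i (e *: x).
Proof. exact: (@smemZ _ _ (tdeg_sub M d i)). Qed.

(** The connecting map on representatives: y is a cycle because D D x = 0 and
    b is strict. *)
Lemma quotient_cycle i n x : Z G' i.+1 (n + beta%:Z) x ->
  exists2 y, Z G i n y & tfil G (n + beta%:Z) (tdiff a x - b *: y).
Proof.
move=> [hx]; have hDx := tdeg_tdiff a hx; move=> /(tfil_quot hDx)[y hy xy].
exists y => //; split=> //; apply: tfil_descale.
have := tfilN (tfil_tdiff ca GG xy).
by rewrite linearB /= (tdiffK a hx) sub0r opprK linearZ.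
Qed.

(** Half of the long exact sequence of multiplication by b, chased on
    representatives: the homology modulo b in degree i + 1 sits between those
    in degrees i + 1 and i. *)
Lemma tacyclic_quot i : tacyclic a c G i -> tacyclic a c G i.+1 ->
  tacyclic a c G' i.+1.
Proof.
move=> ai aS n x; rewrite -(subrK beta%:Z n) => xZ.
have [y /ai[z hz yz] xy] := quotient_cycle xZ.
have [|w hw xw] := aS (n - beta%:Z + beta%:Z) (x - b *: z).
  split; first by apply: tdegB (xZ.1) _; apply: tdegZ.
  rewrite linearB linearZ /=; have := tfilD xy (tfil_scale yz).
  by rewrite scalerBr addrA (subrK (b *: y)).
exists w => //; apply: (@tfil_quot_intro _ _ z).
by rewrite [x - _ - _]addrAC.
Qed.

Lemma tacyclic_quot0 : tacyclic a c G 0 -> tacyclic a c G' 0.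
Proof.
move=> a0 n x [hx _]; have [|y hy xy] := a0 n x.
  by split=> //; rewrite tdeg_tdiff0 //; apply: tfil0.
by exists y => // J; apply: quot_filt_ge.
Qed.

Section Shift.
Variable h : {linear tkoszul -> tkoszul}.
Hypothesis hh : forall x, tdiff a (h x) + h (tdiff a x) = b *: x.
Hypothesis hdeg : forall i x, tdeg i x -> tdeg i.+1 (h x).
Hypothesis hfil : forall n x, tfil G n x -> tfil G (n + beta%:Z) (h x).

Lemma shift_cycle i n x : Z G i n x -> Z G' i.+1 (n + beta%:Z) (h x).
Proof.
move=> [xi Dx]; split; first exact: hdeg.
apply: (@tfil_quot_intro _ _ x); rewrite -hh opprD addrA subrr sub0r.
by apply: tfilN; apply: hfil.
Qed.

(** The homotopy annihilates the action of b on homology, so that the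
    connecting map of the long exact sequence is split by h; both
    implications follow from D h + h D = b and strictness. *)
Lemma shift_boundary i n x : Z G i n x ->
  (B G' i.+1 (n + beta%:Z) (h x) <-> B G i n x).
Proof.
move=> [xi Dx]; split=> [[w hw xw]|[z hz xz]].
  have hdw : tdeg i.+1 (h x - tdiff a w).
    by apply: tdegB; [apply: hdeg|apply: tdeg_tdiff].
  have [z hz xz] := tfil_quot hdw xw; exists z => //; apply: tfil_descale.
  have -> : b *: (x - tdiff a z) =
      tdiff a (h x - tdiff a w - b *: z) + h (tdiff a x).
    rewrite !(linearB (tdiff a)) linearZ /= (tdiffK a hw) subr0.
    by rewrite addrAC hh scalerBr.
  by apply: tfilD; [apply: (tfil_tdiff ca GG)|apply: hfil].
exists (- h z).
  by apply: (@smemN _ _ (tdeg_sub M d i.+2)); apply: hdeg.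
apply: (@tfil_quot_intro _ _ z); rewrite linearN opprK -hh opprD addrA addrK.
by rewrite -linearB; apply: hfil.
Qed.

Lemma shift_surj i n x : tacyclic a c G i.+1 -> Z G' i.+1 (n + beta%:Z) x ->
  exists2 y, Z G i n y & B G' i.+1 (n + beta%:Z) (x - h y).
Proof.
move=> aS xZ; have [y yZ xy] := quotient_cycle xZ; exists y => //.
have [|w hw xw] := aS (n + beta%:Z) (x - h y).
  split; first by apply: tdegB (xZ.1) _; apply: hdeg; exact: yZ.1.
  have := tfilD xy (hfil yZ.2).
  by rewrite linearB /= -hh opprD addrA subrK.
by exists w => // J; apply: quot_filt_ge.
Qed.

End Shift.

Lemma tacyclic_of_quot i : tacyclic a c G' i.+1 -> tacyclic a c G i.
Proof.
move=> aS n x xZ; have [h [hh hdeg hfil]] := homog_comb_homotopy.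
by apply/(shift_boundary hh hdeg hfil xZ)/aS/(shift_cycle hh hdeg hfil).
Qed.

(** Multiplication by b is 0 on homology, so the long exact sequence breaks into
    short ones 0 -> H_(i+1)(G) -> H_(i+1)(G') -> H_i(G) -> 0, whose first term is
    assumed to vanish. The isomorphism is induced by h. *)
Theorem thomology_shift i n : tacyclic a c G i.+1 ->
  lmod_iso (thomology a c G i n) (thomology a c G' i.+1 (n + beta%:Z)).
Proof.
move=> aS; have [h [hh hdeg hfil]] := homog_comb_homotopy.
apply: (subquotient_iso (f := h)) => x.
- exact: shift_cycle.
- exact: shift_boundary.
- exact: shift_surj.
Qed.

End KoszulQuotient.

(** * Comparison with the quotient complex *)
Section Bridge.
Variables (A : comNzRingType) (q : ideal A) (M : lmodType A).
Variables (d : nat) (a : 'I_d -> A) (c : 'I_d -> nat).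
Hypothesis ha : forall j, has_order q (a j) (c j).

Lemma tfil_of_kchain i n (x : kchain M d i) :
  tfil c (filt q M) n%:Z (of_kchain x) <-> ksub q M c n _ x.
Proof.
split=> [h J|h J]; last first.
  rewrite ffunE /kcoef; case: insubP => [J' _ <-|_]; last exact: smem0.
  exact: h.
by have := h (val J); rewrite ffunE /kcoef valK.
Qed.

(** A class modulo the subcomplex is a cycle when any representative has its
    differential in the subcomplex. Both sides are compared with the preimages
    of cycles and boundaries in the Koszul complex. *)
Theorem Lhomology_iso i (n : nat) :
  lmod_iso (Lhomology M ha n i) (thomology a c (filt q M) i n%:Z).
Proof.
set C := Lcomplex M ha n.
pose p : {linear kchain M d i -> chain C i} := @qpi _ _ (ksub q M c n i).
apply: (@lmod_iso_trans _ _ (subquotient (submod_comap p (cycles C i))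
  (submod_comap p (boundaries C i)))).
  apply/lmod_iso_sym/(subquotient_iso (f := p)) => // y yZ.
  exists (qrepr y); first by rewrite /= /p /= qreprK.
  by rewrite /p /= qreprK subrr; exact: (smem0 (boundaries C i)).
have L0 k (x : kchain M d k) : qpi (ksub q M c n k) x = 0 <-> ksub q M c n _ x.
  rewrite -[X in _ = X](linear0 (@qpi _ _ (ksub q M c n k))).
  by split=> [/qpiP|h]; [|apply/qpiP]; rewrite subr0.
apply: (subquotient_iso (f := @of_kchain A M d i)) => x.
- move=> xZ; split; first exact: tdeg_of_kchain.
  case: i x @p xZ => [|i] x p xZ.
    by rewrite tdeg_tdiff0 ?tdeg_of_kchain //; [apply: tfil0|apply: tdeg_of_kchain].
  rewrite tdiff_of_kchain; apply/tfil_of_kchain/L0.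
  by rewrite -(quot_map_pi (@ksub_kdiff A q M d a c ha n i)).
- move=> _; split=> [[y /of_kchain_surj[z ->]]|[y xy]].
    rewrite tdiff_of_kchain -linearB => /tfil_of_kchain/qpiP xz.
    exists (qpi _ z); rewrite /p /= xz.
    by rewrite -(quot_map_pi (@ksub_kdiff A q M d a c ha n i)).
  exists (of_kchain (qrepr y)); first exact: tdeg_of_kchain.
  rewrite tdiff_of_kchain -linearB; apply/tfil_of_kchain/qpiP.
  have := xy; rewrite /p /= => ->.
  by rewrite -[y in LHS]qreprK /= quot_map_pi.
move=> [/of_kchain_surj[y ->] yZ]; exists y; last by rewrite subrr; apply: smem0.
case: i y @p yZ => [|i] y p yZ //.
move: yZ; rewrite tdiff_of_kchain => /tfil_of_kchain/L0.
by rewrite -(quot_map_pi (@ksub_kdiff A q M d a c ha n i)).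
Qed.

(** For nonpositive n the complex is zero, so that natural n suffice. *)
Lemma tacyclic_filt i :
  (forall n : nat, lmod_trivial (Lhomology M ha n i)) <->
  tacyclic a c (filt q M) i.
Proof.
have triv (n : nat) : lmod_trivial (Lhomology M ha n i) <->
    forall x, tcycles a c (filt q M) i n%:Z x -> tbounds a c (filt q M) i n%:Z x.
  rewrite -subquotient_trivial; have h := Lhomology_iso i n.
  split; first exact: (lmod_iso_trivial (lmod_iso_sym h)).
  exact: (lmod_iso_trivial h).
split=> [h [n|n]|h n]; [exact: (triv n).1 (h n) | | exact: (triv n).2 (h n%:Z)].
move=> x _; exists 0; first exact: tdeg0.
move=> J; apply: (qfilt_full (filt_qfiltration q M)).
by rewrite subr_le0.
Qed.

End Bridge.

(** * Filtrations modulo a sequence *)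
Section Combinations.
Variables (R : comPzRingType) (t : nat) (P : pred 'I_t) (b : 'I_t -> R).

Lemma ideal_span_comb x :
  @submod_span R R^o (fun y => exists2 j, P j & y = b j) x <->
  exists s : 'I_t -> R, x = \sum_(j | P j) s j * b j.
Proof.
split=> [|[s ->]]; last first.
  apply: (@smem_sum _ R^o) => j Pj; apply: (@smemZ _ R^o).
  by apply: span_mem; exists j.
pose Q (x : R^o) := exists s : 'I_t -> R, x = \sum_(j | P j) s j * b j.
have Q0 : Q 0 by exists (fun=> 0); rewrite big1 // => j _; rewrite mul0r.
have QL e u v : Q u -> Q v -> Q (e *: u + v).
  move=> [s ->] [s' ->]; exists (fun j => e * s j + s' j).
  rewrite scaler_sumr -big_split; apply: eq_bigr => j _ /=.
  by rewrite mulrDl -mulrA.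
apply: (span_sub (N := Submodule Q0 QL)) => _ [j Pj ->].
exists (fun i => (i == j)%:R); rewrite (bigD1 j) //= eqxx mul1r big1 ?addr0 //.
by move=> i /andP[_ /negPf->]; rewrite mul0r.
Qed.

Lemma ideal_mul_comb (V : lmodType R) (x : V) :
  ideal_mul (@submod_span R R^o (fun y => exists2 j, P j & y = b j)) (full_sub V) x
  <-> exists y : 'I_t -> V, x = \sum_(j | P j) b j *: y j.
Proof.
split=> [|[y ->]]; last first.
  by apply: smem_sum => j Pj; apply: ideal_mulE => //; apply: span_mem; exists j.
pose Q (x : V) := exists y : 'I_t -> V, x = \sum_(j | P j) b j *: y j.
have Q0 : Q 0 by exists (fun=> 0); rewrite big1 // => j _; rewrite scaler0.
have QL e u v : Q u -> Q v -> Q (e *: u + v).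
  move=> [y ->] [z ->]; exists (fun j => e *: y j + z j).
  rewrite scaler_sumr -big_split; apply: eq_bigr => j _ /=.
  by rewrite scalerDr !scalerA mulrC.
apply: (span_sub (N := Submodule Q0 QL)) => _ [r [u [/ideal_span_comb[s ->] _ ->]]].
exists (fun j => s j *: u); rewrite scaler_suml; apply: eq_bigr => j _.
by rewrite scalerA mulrC.
Qed.

End Combinations.

Lemma ideal_gen_comb (R : comPzRingType) t (b : 'I_t -> R) x :
  ideal_gen b x <-> exists s : 'I_t -> R, x = \sum_j s j * b j.
Proof.
rewrite -(ideal_span_comb xpredT); split; apply: span_mono.
  by move=> _ [j ->]; exists j.
by move=> _ [j _ ->]; exists j.
Qed.

Section RegularSequences.
Variables (A : comNzRingType) (q : ideal A) (M : lmodType A).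
Variables (t : nat) (b : 'I_t -> A) (beta : 'I_t -> nat).
Implicit Types (k : nat) (n : int).

Local Notation F := (filt q M).
Local Notation comb k y := (\sum_(j < t | (j < k)%N) b j *: y j).

Definition bfil_pred k n (x : M) : Prop :=
  exists y : 'I_t -> M, F n (x - comb k y).

Lemma comb_lin k e (y z : 'I_t -> M) :
  comb k (fun j => e *: y j + z j) = e *: comb k y + comb k z.
Proof.
rewrite scaler_sumr -big_split; apply: eq_bigr => j _ /=.
by rewrite scalerDr !scalerA mulrC.
Qed.

Lemma comb0 k : comb k (fun=> 0 : M) = 0.
Proof. by rewrite big1 // => j _; rewrite scaler0. Qed.

Fact bfil_pred0 k n : bfil_pred k n 0.
Proof. by exists (fun=> 0); rewrite comb0 subr0; apply: smem0. Qed.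

Fact bfil_pred_lin k n e x x' : bfil_pred k n x -> bfil_pred k n x' ->
  bfil_pred k n (e *: x + x').
Proof.
move=> [y xy] [y' xy']; exists (fun j => e *: y j + y' j).
by rewrite comb_lin opprD addrACA -scalerBr; apply: smem_lin.
Qed.

(** The filtration of M / (b_j, j < k) M induced by the powers of q, pulled back
    to M. *)
Definition bfil k n : submodule M :=
  Submodule (bfil_pred0 k n) (@bfil_pred_lin k n).

Lemma bfil_ge k n x : F n x -> bfil k n x.
Proof. by move=> nx; exists (fun=> 0); rewrite comb0 subr0. Qed.

Lemma bfil0 : bfil 0 = F.
Proof.
apply: funext => n; apply: submod_eq => x; split=> [[y]|]; last exact: bfil_ge.
by rewrite big_pred0 ?subr0.
Qed.

Lemma combS (k : 'I_t) (y : 'I_t -> M) :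
  comb k.+1 y = b k *: y k + comb k y.
Proof.
rewrite (bigD1 k) //=; congr (_ + _); apply: eq_bigl => j.
by rewrite ltnS [RHS]ltn_neqAle andbC.
Qed.

Lemma bfilS (k : 'I_t) : bfil k.+1 = quot_filt (b k) (bfil k).
Proof.
apply: funext => n; apply: submod_eq => x; split=> [[y]|[z [y]]].
  rewrite combS opprD addrA => h; exists (y k); by exists y.
move=> h; exists (fun j => if j == k then z else y j).
rewrite combS eqxx opprD addrA; congr (F n (_ - _)): h.
by apply: eq_bigr => j jk; rewrite -val_eqE ltn_eqF.
Qed.

Lemma bfil_qfiltration k : qfiltration q (bfil k).
Proof.
have FF := filt_qfiltration q M.
split=> [i j x ij [y xy]|i e r x ke [y xy]|i x i0].
- by exists y; apply: (qfilt_anti FF ij).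
- exists (fun j => r *: y j); have := comb_lin k r y (fun=> 0).
  rewrite comb0 addr0 => eq_comb.
  have -> : comb k (fun j => r *: y j) = r *: comb k y.
    by rewrite -eq_comb; apply: eq_bigr => j _; rewrite addr0.
  by rewrite -scalerBr; apply: (qfilt_mul FF).
by apply: bfil_ge; apply: (qfilt_full FF).
Qed.

(** Each element of step n differs from an element of q^n M by one lying in all
    steps; hence representatives of homogeneous elements can be taken in q^n M. *)
Lemma bfil_split k n x : bfil k n x ->
  exists2 v, F n v & forall m, bfil k m (x - v).
Proof.
move=> [y xy]; exists (x - comb k y) => // m; exists y.
by rewrite subKr subrr; apply: smem0.
Qed.

Lemma gen_filtE n x : gen_filt q M b n x <-> bfil t n x.
Proof.
have combT y : comb t y = \sum_j b j *: y j.
  by apply: eq_bigl => j; rewrite ltn_ord.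
have eI u : ideal_mul (ideal_gen b) (full_sub M) u <->
    exists y : 'I_t -> M, u = \sum_j b j *: y j.
  rewrite -(ideal_mul_comb xpredT).
  rewrite /ideal_gen (_ : (fun y => exists2 j, _ & y = b j) =
    (fun y => exists i, y = b i)) //.
  apply: funext => y; apply: propext.
  by split=> [[j _ ->]|[j ->]]; exists j.
split=> [[u [v [/eI[y ->] Fv ->]]]|[y xy]].
  by exists y; rewrite combT addrAC subrr add0r.
exists (comb t y), (x - comb t y); split=> //; last by rewrite addrC subrK.
by apply/eI; exists y; rewrite combT.
Qed.

End RegularSequences.

(** * Regular sequences of initial forms *)
Section GradedRegular.
Variables (A : comNzRingType) (q : ideal A) (M : lmodType A).
Variables (t : nat) (b : 'I_t -> A) (beta : 'I_t -> nat).
Hypothesis hb : forall j, has_order q (b j) (beta j).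

Local Notation F := (filt q M).
Local Notation comb k y := (\sum_(j < t | (j < k)%N) b j *: y j).
Local Notation bfil := (bfil q M b).

Let FF := filt_qfiltration q M.

(** The class of x in degree n lies in the submodule of the graded module
    generated by the first k initial forms. Indices j with beta j > n add
    nothing to the latter, nor do they here: their terms lie in q^(n+1) M, by
    [small_term]. *)
Definition gr_comb k (n : nat) (x : M) : Prop := exists2 y : 'I_t -> M,
  forall j, F (n%:Z - (beta j)%:Z) (y j) & F n.+1%:Z (x - comb k y).

Lemma init_form_scale j (z : reesm q M) :
  init_form (hb j) *: grm_pi z =
  grm_pi (rees_act (rees_mono (hb j).1) z).
Proof. exact: gr_scale_pi. Qed.

Lemma small_term j (n : nat) y : (n < beta j)%N -> F n.+1%:Z (b j *: y).
Proof.
move=> nj; apply: (qfilt_anti FF (j := (beta j)%:Z)); first by rewrite lez_nat.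
have := qfilt_mul FF (hb j).1 (qfilt_full FF y (lexx 0)).
by rewrite add0r.
Qed.

Lemma grm_pi_sum (I : Type) (r : seq I) (P : pred I) (z : I -> reesm q M) :
  \sum_(i <- r | P i) grm_pi (z i) = grm_pi (\sum_(i <- r | P i) z i).
Proof.
have pi0 : grm_pi (0 : reesm q M) = 0.
  by apply: (addIr (grm_pi (0 : reesm q M))); rewrite add0r -grm_piD addr0.
by rewrite (big_morph _ (@grm_piD _ _ _) pi0).
Qed.

Lemma val_reesm_sum (I : Type) (r : seq I) (P : pred I) (z : I -> reesm q M) n :
  val (\sum_(i <- r | P i) z i) n = \sum_(i <- r | P i) val (z i) n.
Proof.
by apply: (big_morph (fun z : reesm q M => val z n)).
Qed.

(** A submodule generated by homogeneous elements is graded, so that membership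
    can be tested in each degree.
    Conversely, coefficients chosen degree by degree are cut off beyond the support
    of z to be finitely many. *)
Lemma grm_pi_ideal k (z : reesm q M) :
  ideal_mul (@submod_span _ (gr_ring q)^o
      (fun y => exists2 j : 'I_t, (j < k)%N & y = init_form (hb j)))
    (full_sub (gr_mod q M)) (grm_pi z) <->
  forall n, gr_comb k n (val z n).
Proof.
rewrite ideal_mul_comb; split=> [[y]|].
  under eq_bigr => j _ do rewrite -(grm_reprK (y j)) init_form_scale.
  rewrite grm_pi_sum => /grm_piP/asboolP zy n.
  exists (fun j => if (beta j <= n)%N then val (grm_repr (y j)) (n - beta j)%N
    else 0).
    move=> j; case: ifP => jn; last exact: smem0.
    by rewrite subzn //; have /asboolP[] := valP (grm_repr (y j)).
  have := zy n; congr (F _ (_ - _)); rewrite val_reesm_sum; apply: eq_bigr => j _.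
  by rewrite [LHS]conv_mono; case: ifP => // _; rewrite scaler0.
move=> zW; have /asboolP[_ [N zN]] := valP z.
have ex n : exists y : 'I_t -> M, (forall j, F (n%:Z - (beta j)%:Z) (y j)) /\
    F n.+1%:Z (val z n - comb k y) by have [y ? ?] := zW n; exists y.
have [y yP] := choice ex.
pose w j m := if (m + beta j < N)%N then y (m + beta j)%N j else 0.
have wP j : w j \in reesmb q (M := M).
  apply/asboolP; split=> [m|].
    rewrite /w; case: ifP => _; last exact: smem0.
    by have := (yP (m + beta j)%N).1 j; rewrite PoszD addrK.
  exists N => m Nm; rewrite /w ltnNge.
  by rewrite (leq_trans Nm) ?leq_addr.
exists (fun j => grm_pi (Reesm (wP j))).
under eq_bigr => j _ do rewrite init_form_scale.
rewrite grm_pi_sum; set S := \sum_(j < t | _) _.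
suff zS n : F n.+1%:Z (val z n - val S n) by apply/grm_piP/asboolP.
rewrite val_reesm_sum.
have act j : val (rees_act (rees_mono (hb j).1) (Reesm (wP j))) n =
    if (beta j <= n)%N then b j *: w j (n - beta j)%N else 0.
  exact: conv_mono.
rewrite (eq_bigr _ (fun j _ => act j)).
have [Nn|nN] := leqP N n.
  rewrite zN // sub0r; apply: smemN; apply: smem_sum => j _.
  case: ifP => jn; last exact: smem0.
  by rewrite /w subnK // ltnNge Nn scaler0; apply: smem0.
rewrite -(subrK (comb k (y n)) (val z n)) -addrA; apply: smemD (yP n).2 _.
rewrite -sumrB; apply: smem_sum => j _.
case: leqP => [jn|nj]; first by rewrite /w subnK // nN subrr; apply: smem0.
by rewrite subr0; apply: small_term.
Qed.

(** Multiplication by an initial form is homogeneous, so that injectivity modulo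
    a graded submodule is a condition on homogeneous elements. *)
Lemma regular_gr_comb :
  regular_seq (gr_mod q M) (fun j => init_form (hb j)) <->
  forall (k : 'I_t) (n : nat) x, F n%:Z x ->
    gr_comb k (n + beta k) (b k *: x) -> gr_comb k n x.
Proof.
have in0 k n : gr_comb k n 0.
  exists (fun=> 0) => [j|]; first exact: smem0.
  by rewrite big1 ?subrr => [|j _]; [apply: smem0|rewrite scaler0].
split=> reg k.
  move=> n x nx kx; have := reg k; set I := ideal_mul _ _ => /= regk.
  have Ix : I (grm_pi (reesm_mono nx)).
    suff /qpiP : qpi I (grm_pi (reesm_mono nx)) = qpi I 0 by rewrite subr0.
    rewrite linear0; apply: regk; rewrite -linearZ /= -[RHS](linear0 (@qpi _ _ I)).
    apply/qpiP; rewrite subr0 init_form_scale; apply/grm_pi_ideal => m.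
    rewrite [val _ m](conv_mono (b k) (beta k) (mseq n x) m) /mseq.
    case: leqP => [km|_]; last exact: in0.
    case: eqP => [e|_]; last by rewrite scaler0; apply: in0.
    by rewrite -(subnK km) e.
  by have /grm_pi_ideal/(_ n) := Ix; rewrite /= /mseq eqxx.
move=> I y; rewrite -(qreprK y) -(grm_reprK (qrepr y)); set z := grm_repr _.
rewrite -linearZ /= -[X in _ = X -> _](linear0 (@qpi _ _ _)) => /qpiP.
rewrite subr0 init_form_scale => /grm_pi_ideal zI.
rewrite -[RHS](linear0 (@qpi _ _ _)); apply/qpiP; rewrite subr0.
apply/grm_pi_ideal => n; apply: reg.
  by have /asboolP[] := valP z.
have := zI (n + beta k)%N.
by rewrite [val _ _](conv_mono (b k) (beta k) (val z)) leq_addl addnK.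
Qed.

(** In the style of Valabrega and Valla: initial forms of the elements of
    (b_j, j < k) M are generated by those of the b_j. Strictness allows the last
    coefficient to be replaced by one of the right degree, at the cost of
    changing the others. *)
Lemma strict_inter k : (k <= t)%N ->
  (forall j : 'I_t, (j < k)%N -> strict (bfil j) (b j) (beta j)) ->
  forall n y, F n (comb k y) -> exists2 y' : 'I_t -> M,
    forall j, F (n - (beta j)%:Z) (y' j) & comb k y = comb k y'.
Proof.
elim: k => [|k IH] kt hk n y ny.
  by exists (fun=> 0) => [j|]; [apply: smem0 | rewrite !big_pred0].
pose k' := Ordinal kt; rewrite (combS b k') in ny *.
have {}IH := IH (ltnW kt) (fun j jk => hk j (ltnW jk)).
have [u nu] : bfil k (n - (beta k')%:Z) (y k').
  apply: (hk k' (ltnSn k)); exists (fun j => - y j).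
  congr (F n (_ + _)): ny; rewrite -sumrN; apply: eq_bigr => j _.
  by rewrite scalerN opprK.
set x' := y k' - _ in nu.
have e : b k' *: y k' + comb k y - b k' *: x' = comb k (fun j => b k' *: u j + y j).
  rewrite comb_lin addrAC -scalerBr; congr (_ + _); congr (_ *: _).
  by rewrite subKr.
have kF : F n (b k' *: x').
  by have := qfilt_mul FF (hb k').1 nu; rewrite subrK.
have [|y' y'F ey'] := IH n (fun j => b k' *: u j + y j).
  by rewrite -e; apply: smemB.
exists (fun j => if j == k' then x' else y' j).
  by move=> j; case: eqP => [->|].
rewrite (combS b k') eqxx -[LHS](subrK (b k' *: x')) e ey' addrC; congr (_ + _).
by apply: eq_bigr => j jk; rewrite -val_eqE ltn_eqF.
Qed.

Lemma gr_comb_of_inter k (n : nat) x :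
  (k <= t)%N ->
  (forall j : 'I_t, (j < k)%N -> strict (bfil j) (b j) (beta j)) ->
  F n%:Z x -> bfil k n.+1%:Z x -> gr_comb k n x.
Proof.
move=> kt hk nx [y xy].
have [|y' y'F ey'] := strict_inter kt hk (n := n%:Z) (y := y).
  rewrite -(subKr x (comb k y)); apply: smemB => //.
  by apply: (qfilt_anti FF) xy; rewrite lez_nat.
by exists y' => //; rewrite -ey'.
Qed.

(** Regularity at index k is strictness up to replacing bfil k by the graded
    submodule of the first k initial forms, and [strict_inter] says that these
    agree, once strictness is known below k. *)
Theorem regular_strict :
  regular_seq (gr_mod q M) (fun j => init_form (hb j)) <->
  forall k : 'I_t, strict (bfil k) (b k) (beta k).
Proof.
rewrite regular_gr_comb; split=> [reg|st k n x nx [y yF xy]]; last first.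
  apply: gr_comb_of_inter nx _ => //; first exact: ltnW.
  have : bfil k (n + beta k).+1%:Z (b k *: x) by exists y.
  by move=> /st; rewrite -addSn PoszD addrK.
suff main k : (k <= t)%N ->
    forall j : 'I_t, (j < k)%N -> strict (bfil j) (b j) (beta j).
  by move=> k; apply: (main t) => //; apply: ltn_ord.
elim: k => // k IH kt j; rewrite ltnS leq_eqVlt => /predU1P[jk|]; last first.
  by apply: IH; apply: ltnW.
have {}IH := IH (ltnW kt); rewrite -jk in IH kt *.
apply: (strict_homog (bfil_qfiltration _ _ _ _)) => n x nx [y xy].
have [v nv xv] := bfil_split nx.
rewrite -(subrK v x); apply: smemD; first exact: xv.
have [u] := xv (n + beta j).+1%:Z; set x' := x - v => x'u.
suff [z _ vz] : gr_comb j n v by exists z.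
apply: reg => //; apply: gr_comb_of_inter => //; first exact: ltnW.
  rewrite PoszD; apply: (qfilt_mul FF) nv; exact: (hb j).1.
rewrite -[v](subKr x) scalerBr; apply: smemB; first by exists y.
by apply: smemZ; apply: xv.
Qed.

Lemma init_form_eq (b' : 'I_t -> A) (hb' : forall j, has_order q (b' j) (beta j)) j :
  idpow q (beta j).+1 (b' j - b j) -> init_form (hb' j) = init_form (hb j).
Proof.
move=> h; apply/gr_piP/asboolP => n.
rewrite (_ : val _ = b' j *: 'X^(beta j) - b j *: 'X^(beta j)) //.
rewrite -scalerBl coefZ coefXn; case: eqP => [->|_]; first by rewrite mulr1.
by rewrite mulr0; apply: (@smem0 _ A^o).
Qed.

End GradedRegular.

(** * The ideal of initial forms *)
Section InitialIdeal.
Variables (A : comNzRingType) (q : ideal A).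
Variables (d : nat) (a : 'I_d -> A) (c : 'I_d -> nat).
Hypothesis ha : forall j, has_order q (a j) (c j).
Variables (b : A) (beta : nat) (hb : has_order q b beta).

Lemma gr_pi_sum (I : Type) (r : seq I) (P : pred I) (z : I -> rees q) :
  \sum_(i <- r | P i) gr_pi (z i) = gr_pi (\sum_(i <- r | P i) z i).
Proof.
have pi0 : gr_pi (0 : rees q) = 0.
  by apply: (addIr (gr_pi (0 : rees q))); rewrite add0r -gr_piD addr0.
by rewrite (big_morph _ (@gr_piD _ _) pi0).
Qed.

Lemma coef_rees_sum (p : 'I_d -> rees q) n :
  (val (\sum_i p i * rees_mono (ha i).1))`_n =
  \sum_i (if (c i <= n)%N then (val (p i))`_(n - c i) * a i else 0).
Proof.
have -> : val (\sum_i p i * rees_mono (ha i).1) =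
    \sum_i val (p i * rees_mono (ha i).1) by rewrite raddf_sum.
rewrite coef_sum; apply: eq_bigr => i _.
rewrite (_ : val _ = val (p i) * (a i *: 'X^(c i))) // -scalerAr coefZ coefMXn.
by case: leqP; rewrite ?mulr0 // mulrC.
Qed.

(** Only the part of degree beta - c_i of the i-th coefficient contributes to
    degree beta. *)
Theorem init_form_ideal :
  ideal_gen (fun i => init_form (ha i)) (init_form hb) <->
  exists2 b', homog_comb q a c b' beta & idpow q beta.+1 (b - b').
Proof.
rewrite ideal_gen_comb; split=> [[s]|[b' [r [hr ->]] bb']].
  under eq_bigr => i _ do rewrite -(gr_reprK (s i)) [_ * _]gr_mul_pi.
  rewrite gr_pi_sum => /gr_piP/asboolP/(_ beta).
  rewrite (_ : val _ = b *: 'X^beta -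
    val (\sum_i gr_repr (s i) * rees_mono (ha i).1)) //.
  rewrite coefB coef_rees_sum coefZ coefXn eqxx mulr1 => h.
  eexists; last exact: h.
  exists (fun i =>
    if (c i <= beta)%N then (val (gr_repr (s i)))`_(beta - c i) else 0).
  split=> [i|]; last by apply: eq_bigr => i _; case: ifP => //; rewrite mul0r.
  case: ifP => ci; last exact: (@smem0 _ A^o).
  by rewrite subzn //; have /asboolP := valP (gr_repr (s i)); apply.
pose s i := if (c i <= beta)%N then r i else 0.
have rP i : idpow q (beta - c i) (s i).
  rewrite /s; case: ifP => ci; last exact: (@smem0 _ A^o).
  by have := hr i; rewrite subzn.
have rn i n : (val (rees_mono (rP i)))`_n = s i * (n == (beta - c i)%N)%:R.
  by rewrite coefZ coefXn.
exists (fun i => gr_pi (rees_mono (rP i))).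
under eq_bigr => i _ do rewrite [_ * _]gr_mul_pi.
rewrite gr_pi_sum; apply/gr_piP/asboolP => n.
rewrite (_ : val _ = b *: 'X^beta -
    val (\sum_i rees_mono (rP i) * rees_mono (ha i).1)) //.
rewrite coefB coef_rees_sum coefZ coefXn.
case: eqP => [->|nb]; last first.
  rewrite mulr0 big1 ?subrr; first exact: (@smem0 _ A^o).
  move=> i _; case: ifP => // ci; rewrite rn.
  case: eqP => [e|_]; last by rewrite mulr0 mul0r.
  rewrite mulr1 /s; case: ifP => cb; last by rewrite mul0r.
  by case: nb; rewrite -(subnK ci) e subnK.
rewrite mulr1 -[b](subrK (\sum_i r i * a i)) -addrA; apply: (@smemD _ A^o) => //.
rewrite -sumrB; apply: (@smem_sum _ A^o) => i _.
rewrite rn eqxx mulr1 /s; case: leqP => ci.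
  by rewrite subrr; apply: (@smem0 _ A^o).
rewrite subr0; apply: (@smemZ _ A^o); apply: idpow_anti (ha i).1.
exact: ci.
Qed.

End InitialIdeal.

(** * Relations and the first homology *)
Section Syzygies.
Variables (A : comNzRingType) (q : ideal A) (M : lmodType A).
Variables (d : nat) (a : 'I_d -> A) (c : 'I_d -> nat).
Hypothesis ca : forall i, idpow q (c i) (a i).
Hypothesis hc : forall i, (0 < c i)%N.

Local Notation F := (filt q M).
Let FF := filt_qfiltration q M.

(** Modulo filtration n, every relation among the first k elements is a
    combination of the Koszul relations a_i e_j - a_j e_i; the alternating matrix y
    holds the coefficients. For k = d this is the vanishing of the first
    homology. *)
Definition trivial_syzygies (k : nat) : Prop := forall (n : int) (x : 'I_d -> M),
  (forall i : 'I_d, (k <= i)%N -> x i = 0) -> F n (\sum_i a i *: x i) ->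
  exists y : 'I_d -> 'I_d -> M,
    [/\ forall i j, y i j = - y j i, forall i, y i i = 0,
        forall i j : 'I_d, (k <= i)%N -> y i j = 0 &
        forall i, F (n - (c i)%:Z) (x i - \sum_j a j *: y i j)].

Lemma below_set1 (i j : 'I_d) : below [set i] j = (i < j)%N.
Proof.
rewrite -[[set i]]setU0 belowU ?inE //.
rewrite /below (_ : [set _ in _ | _] = set0) ?cards0 ?addn0 //.
by apply/setP => l; rewrite !inE.
Qed.

Lemma trivial_syzygies_koszul : tacyclic a c F 1 -> trivial_syzygies d.
Proof.
move=> h1 n x _ xn.
pose X : {ffun {set 'I_d} -> M} :=
  [ffun J : {set _} => \sum_(i | J == [set i]) x i].
have X1 i : X [set i] = x i.
  rewrite ffunE (bigD1 i) //= big1 ?addr0 // => j /andP[/eqP/set1_inj-> ].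
  by rewrite eqxx.
have Xdeg : tdeg 1 X.
  move=> J J1; rewrite ffunE big1 // => i /eqP eJ.
  by rewrite eJ cards1 in J1.
have [|Y Ydeg XY] := h1 n X.
  split=> // J; have [J0|J0] := eqVneq J set0; last first.
    by rewrite (tdeg_tdiff a Xdeg) ?cards_eq0 //; apply: smem0.
  rewrite J0 ffunE /weight big_set0 subr0; congr (F n _): xn.
  apply: eq_big => [i|i _]; first by rewrite inE.
  rewrite setU0 X1 /ksgn /below (_ : [set _ in _ | _] = set0) ?cards0 ?scale1r //.
  by apply/setP => l; rewrite !inE.
exists (fun i j => if i == j then 0 else ksgn A [set i] j *: Y (j |: [set i])).
split=> [i j|i|i j|i]; rewrite ?eqxx //.
- rewrite eq_sym; case: eqP => [_|/eqP ij]; first by rewrite oppr0.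
  rewrite /ksgn !below_set1 setUC -scaleNr; congr (_ *: _).
  have [//|//|/val_inj/eqP] := ltngtP i j; rewrite ?expr0 ?expr1 ?opprK //.
  by rewrite eq_sym (negPf ij).
- by rewrite leqNgt ltn_ord.
have := XY [set i]; rewrite /weight big_set1.
have -> : (X - tdiff a Y) [set i] = X [set i] - tdiff a Y [set i] by rewrite !ffunE.
rewrite X1 ffunE; congr (F _ (_ - _)).
rewrite [RHS](bigD1 i) //= eqxx scaler0 add0r.
apply: eq_big => [j|j]; rewrite inE // eq_sym => /negPf->.
by rewrite !scalerA mulrC.
Qed.

(** A relation that does not involve a_k is trivial as a relation among k + 1
    elements. As its own coefficient at k is 0, the row y k of the witness is a relation
    of filtration n - c_k among the first k elements; induction on n trivializes
    it, and substituting the result removes a_k from the witness. *)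
Lemma trivial_syzygies_pred (k : 'I_d) :
  trivial_syzygies k.+1 -> trivial_syzygies k.
Proof.
move=> Tk n x xk xn.
have [m] : exists m : nat, n <= m%:Z.
  by case: n {xn} => m; [exists m|exists 0%N].
elim: m n x xk xn => [|m IH] n x xk xn nm.
  exists (fun _ _ => 0); split=> // [i j|i]; first by rewrite oppr0.
  by apply: (qfilt_full FF); rewrite subr_le0 (le_trans nm).
have [|y [yN y0 yk yx]] := Tk n x _ xn; first by move=> i /ltnW/xk.
have yk' (i j : 'I_d) : (k < j)%N -> y i j = 0.
  by move=> kj; rewrite yN yk ?oppr0.
(* The coefficients y k j form a relation of smaller order among the a j
   with j < k, which is where c k > 0 enters. *)
have [| | |z [zN z0 zk zx]] := IH (n - (c k)%:Z) (y k).
- move=> i; rewrite leq_eqVlt => /predU1P[/val_inj<- //|]; exact: yk'.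
- by have := yx k; rewrite xk // sub0r => /smemN; rewrite opprK.
- rewrite lerBlDr (le_trans nm) // -addn1 PoszD lerD2l lez_nat; exact: hc.
exists (fun i j : 'I_d =>
  if (i < k)%N && (j < k)%N then y i j - a k *: z i j else 0).
split=> [i j|i|i j ki|i].
- rewrite andbC; case: ifP => _; last by rewrite oppr0.
  by rewrite yN zN scalerN opprB opprK addrC.
- by rewrite y0 z0 scaler0 subrr if_same.
- by rewrite ltnNge ki.
have [ik|ki] := ltnP i k; last first.
  by rewrite xk // big1 ?subrr => [|j _]; [apply: smem0|rewrite scaler0].
have := qfilt_mul FF (ca k) (zx i); rewrite addrAC subrK => h.
have zk' (j : 'I_d) : (k <= j)%N -> z i j = 0.
  by move=> kj; rewrite zN zk ?oppr0.
have -> : \sum_(j < d) a j *: (if true && (j < k)%N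
      then y i j - a k *: z i j else 0) =
    \sum_j a j *: y i j - a k *: y i k - a k *: \sum_j a j *: z i j.
  rewrite (bigD1 k) //= ltnn scaler0 add0r.
  rewrite [X in _ = X - _ - _](bigD1 k) //= [a k *: y i k + _]addrC addrK.
  rewrite [X in _ - _ *: X](bigD1 k) //= zk' // scaler0 add0r scaler_sumr -sumrB.
  apply: eq_bigr => j jk; have [jk'|kj] := ltnP j k.
    by rewrite scalerBr !scalerA mulrC.
  by rewrite zk' // yk' ?scaler0 ?subrr // ltn_neqAle eq_sym jk kj.
have := smemB (yx i) h; congr (F _ _); rewrite (yN i k).
by rewrite scalerN opprK scalerBr -[in RHS]addrA [in RHS]opprD [in RHS]addrA.
Qed.

(** If a_k x is in (a_j, j < k) M up to filtration n, this is a relation with k-th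
    coefficient x; being trivial, it puts x in (a_j, j < k) M up to filtration
    n - c_k. *)
Lemma strict_of_trivial_syzygies (k : 'I_d) :
  trivial_syzygies k.+1 -> strict (bfil q M a k) (a k) (c k).
Proof.
move=> Tk n x [u xu].
pose X (i : 'I_d) := if i == k then x else if (i < k)%N then - u i else 0.
have [| |y [yN y0 yk yx]] := Tk n X.
- move=> i ki; rewrite /X -val_eqE gtn_eqF //= ltnNge ltnW //.
- congr (F n _): xu; rewrite [RHS](bigD1 k) //= /X eqxx; congr (_ + _).
  rewrite -sumrN [RHS](bigID (fun i : 'I_d => (i < k)%N)) /= [X in _ + X]big1 ?addr0.
    apply: eq_big => [i|i ik]; last by rewrite -val_eqE ltn_eqF // ik scalerN.
    by case: ltnP => ik; rewrite ?andbF // -val_eqE ltn_eqF.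
  by move=> i /andP[/negPf-> /negPf->]; rewrite scaler0.
exists (y k); have := yx k; rewrite /X eqxx; congr (F _ (_ - _)).
rewrite [LHS](bigID (fun i : 'I_d => (i < k)%N)) /= [X in _ + X]big1 ?addr0 //.
move=> j; rewrite -leqNgt leq_eqVlt => /predU1P[/val_inj<-|kj].
  by rewrite y0 scaler0.
by rewrite yN yk // oppr0 scaler0.
Qed.

Theorem strict_of_tacyclic1 : tacyclic a c F 1 ->
  forall k : 'I_d, strict (bfil q M a k) (a k) (c k).
Proof.
move=> /trivial_syzygies_koszul Td k; apply: strict_of_trivial_syzygies.
have main e j : (j + e)%N = d -> trivial_syzygies j.
  elim: e j => [|e IH] j; first by rewrite addn0 => ->.
  rewrite addnS => jd; have jd' : (j < d)%N by rewrite -jd ltnS leq_addr.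
  by apply: (@trivial_syzygies_pred (Ordinal jd')); apply: IH; rewrite addSn.
by apply: (main (d - k.+1)%N); rewrite subnKC.
Qed.

End Syzygies.

(** * Homology in the top degree *)
Section TopDegree.
Variables (A : comNzRingType) (q : ideal A) (M : lmodType A).
Variables (d : nat) (a : 'I_d -> A) (c : 'I_d -> nat).
Variable G : int -> submodule M.

Local Notation tkoszul := {ffun {set 'I_d} -> M}.

Definition top_chain (m : M) : tkoszul :=
  [ffun J : {set 'I_d} => if J == setT then m else 0].

Lemma tdeg_top m : tdeg d (top_chain m).
Proof.
move=> J Jd; rewrite ffunE; case: eqP => // JT.
by rewrite JT cardsT card_ord eqxx in Jd.
Qed.

Lemma tdeg_topE x : tdeg d x -> x = top_chain (x setT).
Proof.
move=> hx; apply/ffunP => J; rewrite ffunE; case: eqP => [-> //|/eqP JT].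
apply: hx; apply: contraNneq JT => Jd.
by rewrite eqEcard subsetT cardsT card_ord Jd leqnn.
Qed.

(** In degree d a chain has a single coefficient, and its differential has the
    coefficients a_i m, up to sign, on the complements of the points i. *)
Lemma top_cycle n m : tcycles a c G d n (top_chain m) <->
  forall i, G (n - (\sum_(k | k != i) c k)%N%:Z) (a i *: m).
Proof.
have wC i : weight c (~: [set i]) = (\sum_(k | k != i) c k)%N.
  by congr Posz; apply: eq_bigl => k; rewrite !inE.
split=> [[_ h] i|h].
  have := h (~: [set i]); rewrite wC ffunE.
  rewrite [X in G _ X -> _](big_pred1 i) => [|j]; last first.
    by rewrite !inE negbK.
  rewrite setUCr ffunE eqxx => /(smemZ (ksgn A (~: [set i]) i)).
  by rewrite !scalerA mulrA ksgnK mul1r.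
split=> [|J]; first exact: tdeg_top.
rewrite ffunE; apply: smem_sum => j jJ; apply: smemZ; rewrite ffunE.
case: eqP => [JT|_]; last by rewrite scaler0; apply: smem0.
suff -> : J = ~: [set j] by rewrite wC.
apply/setP => k; rewrite !inE; have [->|kj] := eqVneq k j; first exact/negbTE.
by have := in_setT k; rewrite -JT !inE (negPf kj).
Qed.

Lemma top_boundary n m : tbounds a c G d n (top_chain m) <->
  G (n - (\sum_i c i)%N%:Z) m.
Proof.
have wT : weight c setT = (\sum_i c i)%N.
  by congr Posz; apply: eq_bigl => k; rewrite inE.
split=> [[y yd]|h].
  rewrite (tdeg_large (ltnSn d) yd) linear0 subr0 => /(_ setT).
  by rewrite wT ffunE eqxx.
exists 0; first exact: tdeg0.
rewrite linear0 subr0 => J; rewrite ffunE; case: eqP => [->|_]; last exact: smem0.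
by rewrite wT.
Qed.

Lemma tacyclic_top n m : tacyclic a c G d ->
  (forall i, G (n - (\sum_(k | k != i) c k)%N%:Z) (a i *: m)) ->
  G (n - (\sum_i c i)%N%:Z) m.
Proof. by move=> ad /top_cycle/ad/top_boundary. Qed.

Fact top_coef_linear : linear (fun x : tkoszul => x setT).
Proof. by move=> b x y; rewrite !ffunE. Qed.

Lemma thomology_top n : lmod_iso (thomology a c G d n)
  (subquotient
    (submod_bigcap (fun i => colon (G (n - (\sum_(k | k != i) c k)%N%:Z)) (a i)))
    (G (n - (\sum_i c i)%N%:Z))).
Proof.
pose f : {linear tkoszul -> M} := HB.pack (fun x : tkoszul => x setT)
  (GRing.isLinear.Build A _ _ _ _ top_coef_linear).
apply: (subquotient_iso (f := f)) => [x xZ|x xZ|m mZ].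
- by apply/top_cycle; rewrite -tdeg_topE //; exact: xZ.1.
- by rewrite -top_boundary -tdeg_topE //; exact: xZ.1.
exists (top_chain m); first exact/top_cycle.
by rewrite /= ffunE eqxx subrr; apply: smem0.
Qed.

End TopDegree.

(** * Vanishing and length of regular sequences *)
Section Depth.
Variables (A : comNzRingType) (q : ideal A) (M : lmodType A).
Variables (d : nat) (a : 'I_d -> A) (c : 'I_d -> nat).
Hypothesis ca : forall i, idpow q (c i) (a i).

Local Notation F := (filt q M).

Section Given.
Variables (t : nat) (b : 'I_t -> A) (beta : 'I_t -> nat).
Hypothesis hb : forall j, homog_comb q a c (b j) (beta j).
Hypothesis sb : forall k : 'I_t, strict (bfil q M b k) (b k) (beta k).

Local Notation bfil := (bfil q M b).

(** Descending induction on k. For k = t the claim holds as there are no chains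
    in degrees above d. *)
Lemma tacyclic_bfil e k i :
  (k + e)%N = t -> (d < i + e)%N -> tacyclic a c (bfil k) i.
Proof.
elim: e k i => [|e IH] k i.
  rewrite !addn0 => _ di n x [xi _]; rewrite (tdeg_large di xi).
  exact: smem0.
move=> ke di; have kt : (k < t)%N by rewrite -ke addnS ltnS leq_addr.
pose k' := Ordinal kt.
refine (tacyclic_of_quot ca (bfil_qfiltration q M b k) (hb k') (@sb k') _).
by rewrite -(bfilS q M b k'); apply: IH; rewrite addSnnS.
Qed.

(** Each division by a b_k raises the homological degree by 1 and n by beta k;
    the vanishing needed at each step is [tacyclic_bfil]. *)
Lemma thomology_bfil e k i n : (k + e)%N = t -> (i + e)%N = d ->
  lmod_iso (thomology a c (bfil k) i n)
    (thomology a c (bfil t) d (n + (\sum_(j < t | (k <= j)%N) beta j)%N%:Z)).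
Proof.
elim: e k i n => [|e IH] k i n.
  rewrite !addn0 => -> ->; rewrite big_pred0 ?addr0; last first.
    by move=> j; rewrite leqNgt ltn_ord.
  exact: lmod_iso_refl.
move=> ke ie; have kt : (k < t)%N by rewrite -ke addnS ltnS leq_addr.
pose k' := Ordinal kt.
have aS : tacyclic a c (bfil k') i.+1.
  by apply: (tacyclic_bfil (e := e.+1)) => //; rewrite addSn ie.
have := thomology_shift ca (bfil_qfiltration q M b k) (hb k') (@sb k') n aS.
move=> /lmod_iso_trans; apply; rewrite -bfilS.
rewrite [X in lmod_iso _ (thomology _ _ _ _ X)](_ : _ =
    n + (beta k')%:Z + (\sum_(j < t | (k.+1 <= j)%N) beta j)%N%:Z).
  by apply: (IH k.+1 i.+1); rewrite addSnnS.
rewrite -addrA -PoszD (bigD1 k') //=; congr (_ + Posz (_ + _)).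
by apply: eq_bigl => j; rewrite [RHS]ltn_neqAle andbC eq_sym.
Qed.

Lemma top_quotientE (n : nat) :
  lmod_iso (thomology a c (bfil t) d (n%:Z + (\sum_j beta j)%N%:Z))
    (top_quotient q M a c b beta n).
Proof.
have -> : bfil t = gen_filt q M b.
  by apply: funext => k; apply: submod_eq => x; rewrite gen_filtE.
exact: thomology_top.
Qed.

End Given.

Hypothesis hA : noetherian A.
Hypothesis hM : finitely_generated (full_sub M).
Hypothesis hc : forall i, (0 < c i)%N.
Hypothesis oa : forall i, has_order q (a i) (c i).

(** Vanishing in the top degree d says that no nonzero homogeneous element is
    killed by all a_i, which is what prime avoidance requires. If G is constant
    then every element is strict; otherwise a strict b of degree beta is
    not in q^(beta + 1), as it would send all of M to step beta + 1. *)
Lemma strict_step (i0 : 'I_d) (G : int -> submodule M) : qfiltration q G ->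
  (forall (n : nat) x, G n%:Z x -> exists2 v, F n%:Z v & forall m, G m (x - v)) ->
  tacyclic a c G d ->
  exists b beta, [/\ homog_comb q a c b beta, has_order q b beta & strict G b beta].
Proof.
move=> GG hG aG; have [G1|nG1] := EM (forall x, G 1%:Z x).
  have Gn (n : nat) x : G n%:Z x.
    elim: n x => [|n IH] x; first exact: (qfilt_full GG).
    have [v v1 xv] := hG 1%N x (G1 x).
    rewrite -(subrK v x); apply: smemD; first exact: xv.
    apply: ideal_mul_sub v1 => r y r1 _.
    by have := qfilt_mul GG r1 (IH y); rewrite -PoszD addn1.
  exists (a i0), (c i0); split=> //; first exact: homog_comb_gen.
  move=> n x _; case: (n - _) => [m //|m].
  exact: (qfilt_full GG).
have hJ (u : nat * M) : hnz q G u -> exists i, ~ hann q G u (c i) (a i).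
  case: u => [k x] [/= kx nx]; apply: contrapT => no; apply: nx.
  have := @tacyclic_top A M d a c G (k.+1%:Z + (\sum_i c i)%N%:Z) x aG.
  rewrite addrK; apply => i.
  have [_ /=] : hann q G (k, x) (c i) (a i).
    by apply: contrapT => ni; apply: no; exists i.
  congr (G _ _); rewrite (bigD1 i) //= [in RHS]PoszD addrA addrK.
  by rewrite -PoszD addSn.
have [b [beta [hb sb]]] := strict_exists GG hA hM ca hc hJ hG i0.
exists b, beta; split=> //; split; first exact: homog_comb_idpow hb.
move=> bb; apply: nG1 => x.
have := qfilt_mul GG bb (qfilt_full GG x (lexx 0)).
by rewrite add0r => /sb; rewrite -addn1 PoszD addrAC subrr add0r.
Qed.

Lemma bfil_ext t (b b' : 'I_t -> A) k :
  (forall j : 'I_t, (j < k)%N -> b j = b' j) -> bfil q M b k = bfil q M b' k.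
Proof.
have sub (e e' : 'I_t -> A) n x : (forall j : 'I_t, (j < k)%N -> e j = e' j) ->
    bfil q M e k n x -> bfil q M e' k n x.
  move=> ee' [y xy]; exists y; congr (F n (_ - _)): xy.
  by apply: eq_bigr => j /ee'->.
move=> bb'; apply: funext => n; apply: submod_eq => x; split; apply: sub => //.
by move=> j /bb'.
Qed.

(** Dividing by a strict element shifts the range of vanishing by one degree, so
    that the top homology still vanishes as long as k < t. *)
Theorem strict_sequence_exists t : (d = 0%N -> t = 0%N) ->
  (forall i, (d < i + t)%N -> tacyclic a c F i) ->
  exists (b : 'I_t -> A) (beta : 'I_t -> nat),
    [/\ forall j, homog_comb q a c (b j) (beta j),
        forall j, has_order q (b j) (beta j) &
        forall j : 'I_t, strict (bfil q M b j) (b j) (beta j)].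
Proof.
move=> dt aF.
suff main k : (k <= t)%N -> exists (b : 'I_t -> A) (beta : 'I_t -> nat),
    (forall j : 'I_t, (j < k)%N -> [/\ homog_comb q a c (b j) (beta j),
        has_order q (b j) (beta j) & strict (bfil q M b j) (b j) (beta j)]) /\
    forall i, (d + k < i + t)%N -> tacyclic a c (bfil q M b k) i.
  have [b [beta [bP _]]] := main t (leqnn t).
  by exists b, beta; split=> j; case: (bP j).
elim: k => [|k IH] kt.
  exists (fun=> 0), (fun=> 0%N); split=> // i.
  by rewrite addn0 bfil0; apply: aF.
have [b [beta [bP bA]]] := IH (ltnW kt).
have d0 : (0 < d)%N.
  by case: (posnP d) => // /dt t0; rewrite t0 in kt.
pose k' := Ordinal kt.
have [||b0 [beta0 [hb0 ob0 sb0]]] :=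
  strict_step (Ordinal d0) (bfil_qfiltration q M b k).
- by move=> n x; apply: bfil_split.
- by apply: bA; rewrite ltn_add2l.
pose b' j := if j == k' then b0 else b j.
pose beta' j := if j == k' then beta0 else beta j.
have eb e : (e <= k)%N -> bfil q M b' e = bfil q M b e.
  move=> ek; apply: bfil_ext => j je; rewrite /b' -val_eqE ltn_eqF //.
  exact: leq_trans ek.
exists b', beta'; split=> [j|i].
  rewrite ltnS => jk; rewrite /b' /beta'; case: eqP => [->|/eqP jk'].
    by rewrite -/b' eb.
  have jk2 : (j < k)%N by rewrite ltn_neqAle jk andbT.
  by rewrite -/b' eb //; apply: bP.
rewrite (bfilS q M b' k') /= eb // /b' eqxx.
case: i => [|i] di.
  apply: tacyclic_quot0; apply: bA.
  by rewrite (leq_trans _ di) // ltnS addnS leqnSn.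
apply: (tacyclic_quot ca (bfil_qfiltration q M b k) hb0 sb0); apply: bA.
  by rewrite addnS addSn ltnS in di.
by rewrite (leq_trans _ di) // ltnS addnS leqnSn.
Qed.

End Depth.

(** The homogeneous combination of the a_i found by [init_form_ideal] has the
    initial form of b_j and takes its place. *)
Lemma graded_lift_exists (A : comNzRingType) (q : ideal A) d (a : 'I_d -> A)
    (c : 'I_d -> nat) (ha : forall i, has_order q (a i) (c i))
    t (b : 'I_t -> A) (beta : 'I_t -> nat)
    (hb : forall j, has_order q (b j) (beta j)) :
  (forall j, ideal_gen (fun i => init_form (ha i)) (init_form (hb j))) ->
  exists (b' : 'I_t -> A) (hb' : forall j, has_order q (b' j) (beta j)),
    [/\ forall j, init_form (hb' j) = init_form (hb j),
        forall x, ideal_gen b' x -> ideal_gen a x & graded_lift q a c b' beta].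
Proof.
move=> hI; have ex j : exists b', homog_comb q a c b' (beta j) /\
    idpow q (beta j).+1 (b j - b').
  by have /init_form_ideal[b' ? ?] := hI j; exists b'.
have [b' b'P] := choice ex.
have hb' j : has_order q (b' j) (beta j).
  split; first by apply: (homog_comb_idpow _ (b'P j).1) => i; exact: (ha i).1.
  move=> bb; apply: (hb j).2; rewrite -(subrK (b' j) (b j)).
  exact: (@smemD _ A^o) (b'P j).2 bb.
exists b', hb'; split=> [j|x|j]; last exact: (b'P j).1.
  by apply: init_form_eq; rewrite -opprB; apply: (@smemN _ A^o); exact: (b'P j).2.
apply: (@span_sub _ A^o) => _ [j ->]; apply/ideal_gen_comb.
by have [r [_ ->]] := (b'P j).1; exists r.
Qed.

(** * Rigidity and sensitivity to depth *)
Theorem theorem1p2 (A : comNzRingType) (m : ideal A)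
    (hA : noetherian A) (hm : local_ring m)
    (q : ideal A)
    (M : lmodType A) (hM : finitely_generated (full_sub M))
    (d : nat) (a : 'I_d -> A) (c : 'I_d -> nat)
    (hc : forall i, (0 < c i)%N)
    (ha : forall i, has_order q (a i) (c i)) :
  [/\ (regular_seq (gr_mod q M) (fun i => init_form (ha i)) <->
       forall n : nat, lmod_trivial (Lhomology M ha n 1)) /\
      ((forall n : nat, lmod_trivial (Lhomology M ha n 1)) <->
       forall i n : nat, (0 < i)%N -> lmod_trivial (Lhomology M ha n i)),
      forall (t : nat) (b : 'I_t -> A) (beta : 'I_t -> nat)
        (hb : forall j, has_order q (b j) (beta j)),
        regular_init_forms_in M ha hb ->
        forall i n : nat, (d < i + t)%N -> lmod_trivial (Lhomology M ha n i),
      forall t : nat, (d = 0%N -> t = 0%N) ->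
        (forall i n : nat, (d < i + t)%N -> lmod_trivial (Lhomology M ha n i)) ->
        exists (b : 'I_t -> A) (beta : 'I_t -> nat)
          (hb : forall j, has_order q (b j) (beta j)),
          regular_init_forms_in M ha hb
    & forall (t : nat) (b : 'I_t -> A) (beta : 'I_t -> nat)
        (hb : forall j, has_order q (b j) (beta j)),
        regular_init_forms_in M ha hb ->
        (exists (b' : 'I_t -> A) (hb' : forall j, has_order q (b' j) (beta j)),
           [/\ forall j, init_form (hb' j) = init_form (hb j),
               forall x, ideal_gen b' x -> ideal_gen a x
             & graded_lift q a c b' beta]) /\
        ((forall x, ideal_gen b x -> ideal_gen a x) ->
         graded_lift q a c b beta ->
         forall i n : nat, (i + t = d)%N ->
           lmod_iso (Lhomology M ha n i) (top_quotient q M a c b beta n))].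
Proof.
have ca i : idpow q (c i) (a i) := (ha i).1.
have depth t (b : 'I_t -> A) (beta : 'I_t -> nat)
    (hb : forall j, has_order q (b j) (beta j)) :
    (forall j, homog_comb q a c (b j) (beta j)) ->
    regular_seq (gr_mod q M) (fun j => init_form (hb j)) ->
    forall i, (d < i + t)%N -> tacyclic a c (filt q M) i.
  move=> hba /regular_strict sb i di; rewrite -(bfil0 q M b).
  exact: (tacyclic_bfil ca hba sb (e := t)).
have ac : regular_seq (gr_mod q M) (fun i => init_form (ha i)) ->
    forall i n : nat, (0 < i)%N -> lmod_trivial (Lhomology M ha n i).
  move=> reg i n i0; move: n; apply/tacyclic_filt; apply: (depth _ _ _ ha) => //.
    by move=> j; apply: homog_comb_gen.
  by rewrite -[X in (X < _)%N]add0n ltn_add2r.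
have ba : (forall n : nat, lmod_trivial (Lhomology M ha n 1)) ->
    regular_seq (gr_mod q M) (fun i => init_form (ha i)).
  move=> /tacyclic_filt h1; apply/regular_strict.
  exact: strict_of_tacyclic1.
split.
- split; split=> [h n|h].
  + exact: ac.
  + exact: ba.
  + by move=> i0 i0_gt0; apply: ac => //; apply: ba.
  + by move=> n; apply: h.
- move=> t b beta hb [bI reg] i n di; move: n; apply/tacyclic_filt.
  (* The homology does not depend on b, which may therefore be replaced by a
     homogeneous combination of the a_i with the same initial form. *)
  have [b' [hb' [eb _ lift]]] := graded_lift_exists bI.
  apply: (depth _ _ _ hb') di => //.
  by rewrite (funext eb).
- move=> t dt hL.
  have [|b [beta [hba hb sb]]] := strict_sequence_exists ca hA hM hc ha dt.
    by move=> i di; apply/tacyclic_filt => n; apply: hL.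
  exists b, beta, hb; split; last exact/regular_strict.
  move=> j; apply/init_form_ideal; exists (b j) => //.
  by rewrite subrr; apply: (@smem0 _ A^o).
move=> t b beta hb [bI reg]; split; first exact: graded_lift_exists.
move=> _ lift i n itd; have /regular_strict sb := reg.
apply: lmod_iso_trans (Lhomology_iso M ha i n) _; rewrite -(bfil0 q M b).
apply: lmod_iso_trans (thomology_bfil ca lift sb n%:Z (add0n t) itd) _.
exact: top_quotientE.
Qed.
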